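(* Let $\mathcal V$ be a polarized arrangement and let $\alpha\in\mathcal P$. Then the standard module $\tilde V_\alpha$ for $\tilde A(\mathcal V)$ has a linear projective resolution by projectives $\tilde P_\beta$ for $\beta\in\mathcal F_{\mathbf x_\alpha}\cap\mathcal B$.
   Context: **Polarized arrangements.** Let $0\le k\le n$ and $I=\{1,\dots,n\}$. A polarized arrangement $\mathcal V=(V,\eta,\xi)$ consists of a $k$-dimensional subspace $V\subset\mathbb R^n$, $\eta\in\mathbb R^n/V$ and $\xi\in V^*=(\mathbb R^n)^*/V^\perp$ such that every lift of $\eta$ to $\mathbb R^n$ has at least $n-k$ nonzero entries and every lift of $\xi$ to $(\mathbb R^n)^*$ has at least $k$ nonzero entries. Put $V_\eta=\{x\in\mathbb R^n: x+V=\eta\}$, $H_i=\{x\in V_\eta:x_i=0\}$, $H_S=\bigcap_{i\in S}H_i$. For $\alpha\in\{\pm1\}^n$ let $\Delta_\alpha=\{x\in V_\eta:\alpha(i)x_i\ge0\ \forall i\}$ and $\Sigma_\alpha=\{x\in V:\alpha(i)x_i\ge0\ \forall i\}$. Set $\mathcal F=\{\alpha:\Delta_\alpha\ne\emptyset\}$, $\mathcal B=\{\alpha:\xi(\Sigma_\alpha)\text{ bounded above}\}$, $\mathcal P=\mathcal F\cap\mathcal B$. Write $\alpha\leftrightarrow\beta$ if $\alpha,\beta$ differ in exactly one entry, and $\alpha^i$ for $\alpha$ with the $i$-th entry flipped. Let $\mathbb B$ be the set of $k$-element subsets $\mathbf x\subset I$ with $H_{\mathbf x}\neq\emptyset$ (then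 a point). There is a bijection $\mu:\mathbb B\to\mathcal P$ sending $\mathbf x$ to the unique $\alpha\in\mathcal P$ such that $\xi$ attains its maximum on $\Delta_\alpha$ at $H_{\mathbf x}$; write $\mathbf x_\alpha=\mu^{-1}(\alpha)$. For $\mathbf x\in\mathbb B$, the feasible cone is $\mathcal F_{\mathbf x}=\{\gamma\in\{\pm1\}^n:\gamma(i)=\mu(\mathbf x)(i)\ \forall i\notin\mathbf x\}$. **The algebra $\tilde A(\mathcal V)$** (over $\mathbb Z$). Take the quiver with vertex set $\mathcal F$ and an arrow $p(\alpha,\beta)$ from $\alpha$ to $\beta$ whenever $\alpha\leftrightarrow\beta$ in $\mathcal F$; paths are read left to right, so $p(\alpha,\beta)=e_\alpha p(\alpha,\beta)e_\beta$. $\tilde A(\mathcal V)$ is the path algebra tensored with $\mathbb Z[t_1,\dots,t_n]$ modulo the two-sided ideal generated by: (A1) $e_\alpha$ for $\alpha\in\mathcal F\setminus\mathcal B$; (A2) $p(\alpha,\beta)p(\beta,\gamma)-p(\alpha,\delta)p(\delta,\gamma)$ for distinct $\alpha,\beta,\gamma,\delta\in\mathcal F$ with $\alpha\leftrightarrow\beta\leftrightarrow\gamma\leftrightarrow\delta\leftrightarrow\alpha$; (A3) $p(\alpha,\beta)p(\beta,\alpha)-t_ie_\alpha$ for $\alpha\leftrightarrow\beta$ in $\mathcal F$ differing in coordinate $i$. Grading: $\deg p(\alpha,\beta)=1$, $\deg t_i=2$. For $\alpha\in\mathcal P$: $\tilde P_\alpha=\tilde A(\mathcal V)e_\alpha$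 and $\tilde V_\alpha=\tilde A e_\alpha/\sum_{i\in\mathbf x_\alpha}\tilde A\,p(\alpha^i,\alpha)$ (graded left modules). **Linear resolution.** With the shift $(qM)_m=M_{m-1}$, a projective resolution of a graded module (with degree-preserving maps) is linear if each indecomposable projective summand in homological degree $i$ is shifted upward by $i$; so here the term in homological degree $i$ is a direct sum of modules $q^i\tilde P_\beta$ with $\beta\in\mathcal F_{\mathbf x_\alpha}\cap\mathcal B$. *)

(* Defs.v *)
From HB Require Import structures.
From mathcomp Require Import all_boot all_order all_algebra generic_quotient.
From mathcomp Require Import ring_quotient boolp classical_sets reals.
From mathcomp Require Import finmap.
From mathcomp Require Import monalg.
From mathcomp Require Import mpoly.

Set Implicit Arguments.
Unset Strict Implicit.
Unset Printing Implicit Defensive.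

Import Order.TTheory GRing.Theory Num.Theory.
Import Quotient.
Local Open Scope ring_scope.
Local Open Scope quotient_scope.

(* The quiver has vertex set W and one arrow x -> y whenever x, y \in W and
   e x y.  As arrows are determined by their endpoints, a path x_0 -> ... -> x_m
   (m >= 0) is the nonempty sequence of its vertices. *)
Section PathAlgebra.
Variables (S : comNzRingType) (T : finType) (W : {set T}) (e : rel T).

Definition is_qpath (s : seq T) : bool :=
  if s is x :: s' then all (mem W) s && path e x s' else false.

Definition qpath := {s : seq T | is_qpath s}.
HB.instance Definition _ := SubChoice.on qpath.

Definition path_algebra : Type := monalg.malg qpath S.
HB.instance Definition _ := GRing.Lmodule.on path_algebra.

Implicit Types (p q : qpath) (f g : path_algebra).

Definition path_basis p : path_algebra := monalg.mkmalgU p 1.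

(* 0 when s is not a path of the quiver *)
Definition path_elt (s : seq T) : path_algebra :=
  if insub s is Some p then path_basis p else 0.

Definition path_mul (s r : seq T) : path_algebra :=
  match s, r with
  | x :: s', y :: r' => if last x s' == y then path_elt (x :: s' ++ r') else 0
  | _, _ => 0
  end.

Definition lin_ext (h : qpath -> path_algebra) f : path_algebra :=
  \sum_(p <- enum_fset (monalg.msupp f)) monalg.mcoeff p f *: h p.

Definition pa_mul f g : path_algebra :=
  lin_ext (fun p => lin_ext (fun q => path_mul (val p) (val q)) g) f.

Definition pa_one : path_algebra := \sum_(x in W) path_elt [:: x].

Lemma lin_extEw h f (d : {fset qpath}) :
  (monalg.msupp f `<=` d)%fset ->
  lin_ext h f = \sum_(p <- enum_fset d) monalg.mcoeff p f *: h p.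
Proof.
move=> le; apply: finmap.big_fset_incl => // p _ /monalg.mcoeff_outdom ->.
by rewrite scale0r.
Qed.

Lemma lin_extP h a f g : lin_ext h (a *: f + g) = a *: lin_ext h f + lin_ext h g.
Proof.
pose d := finmap.fsetU (monalg.msupp f) (monalg.msupp g).
have lf : finmap.fsubset (monalg.msupp f) d by apply: finmap.fsubsetUl.
have lg : finmap.fsubset (monalg.msupp g) d by apply: finmap.fsubsetUr.
have lfg : finmap.fsubset (monalg.msupp (a *: f + g : monalg.malg _ _)) d.
  apply: finmap.fsubset_trans (monalg.msuppD_le _ _) _; apply: finmap.fsetSU.
  exact: monalg.msuppZ_le.
rewrite (lin_extEw h lf) (lin_extEw h lg) (lin_extEw h lfg).
rewrite scaler_sumr -big_split /=; apply: eq_bigr => p _.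
by rewrite monalg.mcoeffD monalg.mcoeffZ scalerDl scalerA.
Qed.
HB.instance Definition _ h :=
  GRing.isLinear.Build S path_algebra path_algebra *:%R (lin_ext h)
    (fun a f g => lin_extP h a f g).

Lemma lin_extU h p : lin_ext h (path_basis p) = h p.
Proof.
rewrite (@lin_extEw h _ (finmap.fset1 p)); last exact: monalg.msuppU_le.
by rewrite finmap.big_seq_fset1 monalg.mcoeffUU scale1r.
Qed.

Lemma path_algebra_ind (P : path_algebra -> Prop) :
  P 0 -> (forall f g, P f -> P g -> P (f + g)) ->
  (forall a p, P (a *: path_basis p)) -> forall f, P f.
Proof.
move=> P0 PD PZ f; rewrite (monalg.monalgE f); apply: big_ind => // p _.
have -> : monalg.mkmalgU p (monalg.mcoeff p f) =
    monalg.mcoeff p f *: path_basis p.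
  apply/monalg.malgP => q; rewrite monalg.mcoeffZ !monalg.mcoeffU.
  by rewrite mulrnAr mulr1.
exact: PZ.
Qed.

Lemma pa_mulPl a f g h : pa_mul (a *: f + g) h = a *: pa_mul f h + pa_mul g h.
Proof. exact: lin_extP. Qed.

Lemma pa_mulPr a f g h : pa_mul f (a *: g + h) = a *: pa_mul f g + pa_mul f h.
Proof.
rewrite /pa_mul /lin_ext scaler_sumr -big_split /=; apply: eq_bigr => p _.
by rewrite -!/(lin_ext _ _) lin_extP scalerDr !scalerA mulrC.
Qed.

Lemma pa_mulDl : left_distributive pa_mul +%R.
Proof. by move=> f g h; have := pa_mulPl 1 f g h; rewrite !scale1r. Qed.

Lemma pa_mulDr : right_distributive pa_mul +%R.
Proof. by move=> f g h; have := pa_mulPr 1 f g h; rewrite !scale1r. Qed.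

Lemma pa_mul0r g : pa_mul 0 g = 0.
Proof. by apply: (addrI (pa_mul 0 g)); rewrite -pa_mulDl !addr0. Qed.

Lemma pa_mulr0 f : pa_mul f 0 = 0.
Proof. by apply: (addrI (pa_mul f 0)); rewrite -pa_mulDr !addr0. Qed.

Lemma pa_mulZl a f g : pa_mul (a *: f) g = a *: pa_mul f g.
Proof. by have := pa_mulPl a f 0 g; rewrite pa_mul0r !addr0. Qed.

Lemma pa_mulZr a f g : pa_mul f (a *: g) = a *: pa_mul f g.
Proof. by have := pa_mulPr a f g 0; rewrite pa_mulr0 !addr0. Qed.

Lemma pa_mul_basis p q :
  pa_mul (path_basis p) (path_basis q) = path_mul (val p) (val q).
Proof. by rewrite /pa_mul !lin_extU. Qed.

Lemma path_elt_val p : path_elt (val p) = path_basis p.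
Proof. by rewrite /path_elt valK. Qed.

Lemma path_eltM s r : is_qpath s -> is_qpath r ->
  pa_mul (path_elt s) (path_elt r) = path_mul s r.
Proof.
move=> ps pr; rewrite -[s]/(val (Sub s ps : qpath)) -[r]/(val (Sub r pr : qpath)).
by rewrite !path_elt_val pa_mul_basis.
Qed.

Lemma is_qpath1 x : is_qpath [:: x] = (x \in W).
Proof. by rewrite /= !andbT. Qed.

Lemma is_qpath_cat x s y r : is_qpath (x :: s) -> is_qpath (y :: r) ->
  last x s = y -> is_qpath (x :: s ++ r).
Proof.
rewrite /= all_cat cat_path => /andP[/andP[-> ->] ->] /andP[/andP[_ ->] yr] ->.
by rewrite yr.
Qed.

Lemma path_mulA_subproof s r t : is_qpath s -> is_qpath r -> is_qpath t ->
  pa_mul (path_mul s r) (path_elt t) = pa_mul (path_elt s) (path_mul r t).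
Proof.
case: s r t => // x s [//|y r] [//|z t] ps pr pt; rewrite [path_mul (x :: _) _]/=.
rewrite [path_mul (y :: _) _]/=.
case: eqP => [xy|xy]; case: eqP => [yz|yz]; rewrite ?pa_mul0r ?pa_mulr0 //.
- rewrite !path_eltM ?(is_qpath_cat ps pr) ?(is_qpath_cat pr pt) //=.
  by rewrite last_cat xy yz !eqxx catA.
- rewrite path_eltM ?(is_qpath_cat ps pr) //= last_cat xy.
  by case: eqP.
- rewrite path_eltM ?(is_qpath_cat pr pt) //=.
  by case: eqP.
Qed.

Lemma pa_mulA : associative pa_mul.
Proof.
move=> f g h; elim/path_algebra_ind: f => [|f f' ef ef'|a p].
- by rewrite !pa_mul0r.
- by rewrite !pa_mulDl ef ef'.
rewrite !pa_mulZl; congr (_ *: _).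
elim/path_algebra_ind: g => [|g g' eg eg'|b q].
- by rewrite !(pa_mul0r, pa_mulr0).
- by rewrite !(pa_mulDl, pa_mulDr) eg eg'.
rewrite !(pa_mulZl, pa_mulZr); congr (_ *: _).
elim/path_algebra_ind: h => [|h h' eh eh'|c r].
- by rewrite !pa_mulr0.
- by rewrite !pa_mulDr eh eh'.
rewrite !pa_mulZr; congr (_ *: _).
rewrite !pa_mul_basis -!path_elt_val path_mulA_subproof //; exact: valP.
Qed.

Lemma pa_mul1r : left_id pa_one pa_mul.
Proof.
elim/path_algebra_ind => [|f g ef eg|a p].
- exact: pa_mulr0.
- by rewrite pa_mulDr ef eg.
rewrite pa_mulZr; congr (_ *: _).
have sumE h := big_morph (pa_mul^~ h)
  (fun u v => pa_mulDl u v h) (pa_mul0r h); rewrite /pa_one sumE {sumE}.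
rewrite -path_elt_val; case: p => -[//|x s] ps /=.
have xW : x \in W by case/andP: (ps) => /andP[].
rewrite (bigD1 x) //= path_eltM ?is_qpath1 //= eqxx big1 ?addr0 // => y.
by case/andP=> yW /negPf nyx; rewrite path_eltM ?is_qpath1 //= nyx.
Qed.

Lemma pa_mulr1 : right_id pa_one pa_mul.
Proof.
elim/path_algebra_ind => [|f g ef eg|a p].
- exact: pa_mul0r.
- by rewrite pa_mulDl ef eg.
rewrite pa_mulZl; congr (_ *: _).
have sumE h := big_morph (pa_mul h)
  (fun u v => pa_mulDr h u v) (pa_mulr0 h); rewrite /pa_one sumE {sumE}.
rewrite -path_elt_val; case: p => -[//|x s] ps /=.
have lW : last x s \in W.
  have /andP[/allP sW _] : is_qpath (x :: s) by [].
  exact/sW/mem_last.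
rewrite (bigD1 (last x s)) //= path_eltM ?is_qpath1 //= eqxx cats0.
rewrite big1 ?addr0 // => y /andP[yW nyx].
by rewrite path_eltM ?is_qpath1 //= eq_sym (negPf nyx).
Qed.

HB.instance Definition _ := GRing.Zmodule_isPzRing.Build path_algebra
  pa_mulA pa_mul1r pa_mulr1 pa_mulDl pa_mulDr.

End PathAlgebra.

Section RingQuotient.
Variables (R : pzRingType) (X : R -> Prop).

Inductive in_ideal : R -> Prop :=
| in_ideal0 : in_ideal 0
| in_idealD a x b y : X x -> in_ideal y -> in_ideal (a * x * b + y).

Definition ideal_pred : {pred R} := fun x => `[< in_ideal x >].

Lemma ideal_predP x : reflect (in_ideal x) (x \in ideal_pred).
Proof. exact: asboolP. Qed.

Lemma ideal_pred_mul u v x : x \in ideal_pred -> u * x * v \in ideal_pred.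
Proof.
move=> /ideal_predP xI; apply/ideal_predP; elim: xI => [|a z b y Xz _ IH].
  by rewrite mulr0 mul0r; left.
by rewrite mulrDr mulrDl !mulrA -(mulrA _ b v); right.
Qed.

Lemma ideal_pred_zmod : zmod_closed ideal_pred.
Proof.
split=> [|x y]; first by apply/ideal_predP; left.
move=> /ideal_predP xI yI; apply/ideal_predP; elim: xI => [|a z b w Xz _ IH].
  rewrite sub0r; apply/ideal_predP.
  by rewrite -mulN1r -[_ * y]mulr1; apply: ideal_pred_mul.
by rewrite -addrA; right.
Qed.
HB.instance Definition _ := GRing.isZmodClosed.Build R ideal_pred ideal_pred_zmod.

Definition ring_quot : Type := {quot ideal_pred}.
HB.instance Definition _ := GRing.Zmodule.on ring_quot.

Definition rq_pi (x : R) : ring_quot := \pi_({quot ideal_pred}) x.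

Lemma rq_pi_zmod : zmod_morphism rq_pi.
Proof. by move=> x y; rewrite /rq_pi raddfB. Qed.
HB.instance Definition _ := GRing.isZmodMorphism.Build R ring_quot rq_pi rq_pi_zmod.

Lemma rq_piP (y : ring_quot) : exists x, rq_pi x = y.
Proof. by exists (repr (y : {quot ideal_pred})); rewrite /rq_pi reprK. Qed.

Lemma rq_pi_eq x y : rq_pi x = rq_pi y <-> in_ideal (x - y).
Proof.
split=> [/eqP|xy]; last by apply/eqP; rewrite /rq_pi piE equivE; apply/ideal_predP.
by rewrite /rq_pi piE equivE => /ideal_predP.
Qed.

Definition rq_one : ring_quot := rq_pi 1.
Definition rq_mul (x y : ring_quot) : ring_quot :=
  rq_pi (repr (x : {quot ideal_pred}) * repr (y : {quot ideal_pred})).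

Lemma rq_pi_mul x y : rq_mul (rq_pi x) (rq_pi y) = rq_pi (x * y).
Proof.
have reprP z : repr (rq_pi z : {quot ideal_pred}) - z \in ideal_pred.
  by apply/ideal_predP/rq_pi_eq; rewrite /rq_pi reprK.
apply/rq_pi_eq/ideal_predP; set x' := repr _; set y' := repr _.
have -> : x' * y' - x * y = 1 * (x' - x) * y' + x * (y' - y) * 1.
  by rewrite mul1r mulr1 mulrBl mulrBr addrA subrK.
by apply: rpredD; apply: ideal_pred_mul; apply: reprP.
Qed.

Lemma rq_mulA : associative rq_mul.
Proof.
move=> x y z; have [[x' <-] [y' <-] [z' <-]] := And3 (rq_piP x) (rq_piP y) (rq_piP z).
by rewrite !rq_pi_mul mulrA.
Qed.

Lemma rq_mul1r : left_id rq_one rq_mul.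
Proof. by move=> x; have [x' <-] := rq_piP x; rewrite rq_pi_mul mul1r. Qed.

Lemma rq_mulr1 : right_id rq_one rq_mul.
Proof. by move=> x; have [x' <-] := rq_piP x; rewrite rq_pi_mul mulr1. Qed.

Lemma rq_mulDl : left_distributive rq_mul +%R.
Proof.
move=> x y z; have [[x' <-] [y' <-] [z' <-]] := And3 (rq_piP x) (rq_piP y) (rq_piP z).
by rewrite -raddfD !rq_pi_mul mulrDl raddfD.
Qed.

Lemma rq_mulDr : right_distributive rq_mul +%R.
Proof.
move=> x y z; have [[x' <-] [y' <-] [z' <-]] := And3 (rq_piP x) (rq_piP y) (rq_piP z).
by rewrite -raddfD !rq_pi_mul mulrDr raddfD.
Qed.

HB.instance Definition _ := GRing.Zmodule_isPzRing.Build ring_quot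
  rq_mulA rq_mul1r rq_mulr1 rq_mulDl rq_mulDr.

Lemma rq_pi_monoid : monoid_morphism rq_pi.
Proof. by split=> // x y; rewrite -rq_pi_mul. Qed.
HB.instance Definition _ := GRing.isMonoidMorphism.Build R ring_quot rq_pi rq_pi_monoid.

End RingQuotient.

Section ModuleQuotient.
Variables (A : pzRingType) (M : lmodType A) (X : M -> Prop).

Inductive in_submod : M -> Prop :=
| in_submod0 : in_submod 0
| in_submodD a x y : X x -> in_submod y -> in_submod (a *: x + y).

Definition submod_pred : {pred M} := fun x => `[< in_submod x >].

Lemma submod_predP x : reflect (in_submod x) (x \in submod_pred).
Proof. exact: asboolP. Qed.

Lemma submod_pred_scale a x : x \in submod_pred -> a *: x \in submod_pred.
Proof.
move=> /submod_predP xN; apply/submod_predP; elim: xN => [|b z y Xz _ IH].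
  by rewrite scaler0; left.
by rewrite scalerDr scalerA; right.
Qed.

Lemma submod_pred_zmod : zmod_closed submod_pred.
Proof.
split=> [|x y]; first by apply/submod_predP; left.
move=> /submod_predP xN yN; apply/submod_predP; elim: xN => [|a z w Xz _ IH].
  by rewrite sub0r -scaleN1r; apply/submod_predP/submod_pred_scale.
by rewrite -addrA; right.
Qed.
HB.instance Definition _ := GRing.isZmodClosed.Build M submod_pred submod_pred_zmod.

Definition mod_quot : Type := {quot submod_pred}.
HB.instance Definition _ := GRing.Zmodule.on mod_quot.

Definition mq_pi (x : M) : mod_quot := \pi_({quot submod_pred}) x.

Lemma mq_piP (y : mod_quot) : exists x, mq_pi x = y.
Proof. by exists (repr (y : {quot submod_pred})); rewrite /mq_pi reprK. Qed.

Lemma mq_pi_eq x y : mq_pi x = mq_pi y <-> in_submod (x - y).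
Proof.
split=> [/eqP|xy]; last by apply/eqP; rewrite /mq_pi piE equivE; apply/submod_predP.
by rewrite /mq_pi piE equivE => /submod_predP.
Qed.

Lemma mq_piD x y : mq_pi (x + y) = mq_pi x + mq_pi y.
Proof. by rewrite /mq_pi raddfD. Qed.

Definition mq_scale (a : A) (x : mod_quot) : mod_quot := mq_pi (a *: repr (x : {quot submod_pred})).

Lemma mq_pi_scale a x : mq_scale a (mq_pi x) = mq_pi (a *: x).
Proof.
apply/mq_pi_eq; rewrite -scalerBr; apply/submod_predP/submod_pred_scale.
by apply/submod_predP/mq_pi_eq; rewrite /mq_pi reprK.
Qed.

Lemma mq_scaleA a b x : mq_scale a (mq_scale b x) = mq_scale (a * b) x.
Proof. by have [y <-] := mq_piP x; rewrite !mq_pi_scale scalerA. Qed.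

Lemma mq_scale1 : left_id 1 mq_scale.
Proof. by move=> x; have [y <-] := mq_piP x; rewrite mq_pi_scale scale1r. Qed.

Lemma mq_scaleDr : right_distributive mq_scale +%R.
Proof.
move=> a x y; have [[x' <-] [y' <-]] := conj (mq_piP x) (mq_piP y).
by rewrite -mq_piD !mq_pi_scale scalerDr mq_piD.
Qed.

Lemma mq_scaleDl x : {morph mq_scale^~ x : a b / a + b}.
Proof.
by move=> a b; have [y <-] := mq_piP x; rewrite !mq_pi_scale scalerDl mq_piD.
Qed.

HB.instance Definition _ := GRing.Zmodule_isLmodule.Build A mod_quot
  mq_scaleA mq_scale1 mq_scaleDr mq_scaleDl.

Lemma mq_pi_linear : linear mq_pi.
Proof. by move=> a x y; rewrite mq_piD -mq_pi_scale. Qed.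
HB.instance Definition _ := GRing.isLinear.Build A M mod_quot *:%R mq_pi mq_pi_linear.

End ModuleQuotient.

Section PrincipalModule.
Variables (A : pzRingType) (u : A).

Definition in_principal : {pred A^o} := fun x => `[< exists a : A, x = a * u >].

Lemma in_principal_submod : submod_closed in_principal.
Proof.
split=> [|a x y]; first by apply/asboolP; exists 0; rewrite mul0r.
move=> /asboolP[b ->] /asboolP[c ->]; apply/asboolP; exists (a * b + c).
by rewrite mulrDl -mulrA.
Qed.
HB.instance Definition _ :=
  GRing.isSubmodClosed.Build A A^o in_principal in_principal_submod.

Definition principal := {x : A^o | x \in in_principal}.
HB.instance Definition _ := SubChoice.on principal.
HB.instance Definition _ := [SubChoice_isSubLmodule of principal by <:].

End PrincipalModule.

Section DirectSum.
Variables (A : pzRingType) (J : finType) (M : J -> lmodType A).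

Definition dsum : Type := {dffun forall j : J, M j}.
HB.instance Definition _ := Choice.on dsum.
Implicit Types x y : dsum.

Definition dsum_zero : dsum := [ffun j => 0].
Definition dsum_opp x : dsum := [ffun j => - x j].
Definition dsum_add x y : dsum := [ffun j => x j + y j].
Definition dsum_scale a x : dsum := [ffun j => a *: x j].

Lemma dsum_addA : associative dsum_add.
Proof. by move=> x y z; apply/ffunP=> j; rewrite !ffunE addrA. Qed.
Lemma dsum_addC : commutative dsum_add.
Proof. by move=> x y; apply/ffunP=> j; rewrite !ffunE addrC. Qed.
Lemma dsum_add0 : left_id dsum_zero dsum_add.
Proof. by move=> x; apply/ffunP=> j; rewrite !ffunE add0r. Qed.
Lemma dsum_addN : left_inverse dsum_zero dsum_opp dsum_add.
Proof. by move=> x; apply/ffunP=> j; rewrite !ffunE addNr. Qed.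
HB.instance Definition _ :=
  GRing.isZmodule.Build dsum dsum_addA dsum_addC dsum_add0 dsum_addN.

Lemma dsum_scaleA a b x : dsum_scale a (dsum_scale b x) = dsum_scale (a * b) x.
Proof. by apply/ffunP=> j; rewrite !ffunE scalerA. Qed.
Lemma dsum_scale1 : left_id 1 dsum_scale.
Proof. by move=> x; apply/ffunP=> j; rewrite !ffunE scale1r. Qed.
Lemma dsum_scaleDr : right_distributive dsum_scale +%R.
Proof. by move=> a x y; apply/ffunP=> j; rewrite !ffunE scalerDr. Qed.
Lemma dsum_scaleDl x : {morph dsum_scale^~ x : a b / a + b}.
Proof. by move=> a b; apply/ffunP=> j; rewrite !ffunE scalerDl. Qed.
HB.instance Definition _ := GRing.Zmodule_isLmodule.Build A dsum
  dsum_scaleA dsum_scale1 dsum_scaleDr dsum_scaleDl.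

End DirectSum.

(* A left module together with the sets of its homogeneous elements of each
   degree d : int.  Only this data is recorded: it is used for concrete modules,
   to say that maps preserve degrees. *)
Record graded_module (A : pzRingType) := GradedModule {
  gm_sort :> lmodType A;
  homogeneous : int -> gm_sort -> Prop
}.

(* (q^i M)_d = M_(d - i) *)
Definition gshift (A : pzRingType) (i : int) (M : graded_module A) :=
  @GradedModule A M (fun d x => homogeneous (d - i) x).

Definition gsum (A : pzRingType) (J : finType) (M : J -> graded_module A) :=
  @GradedModule A (@dsum A J M) (fun d x => forall j, homogeneous d (x j)).

Definition projective (A : pzRingType) (P : lmodType A) : Prop :=
  forall (M N : lmodType A) (g : {linear M -> N}) (f : {linear P -> N}),
    (forall y, exists x, g x = y) ->
    exists h : {linear P -> M}, forall x, g (h x) = f x.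

Definition degree_preserving (A : pzRingType) (M N : graded_module A)
    (f : {linear M -> N}) : Prop :=
  forall d x, homogeneous d x -> homogeneous d (f x).

(* ... -> C_1 -> C_0 -> M -> 0, where C_i is a finite direct sum of modules
   q^i P_b with b \in B. *)
Definition has_linear_resolution (A : pzRingType) (I : Type)
    (P : I -> graded_module A) (B : {pred I}) (M : graded_module A) : Prop :=
  exists (J : nat -> finType) (b : forall i, J i -> I),
    let C i := gsum (fun j : J i => gshift i%:Z (P (b i j))) in
    exists (d : forall i, {linear C i.+1 -> C i}) (aug : {linear C 0%N -> M}),
      [/\ forall i j, b i j \in B, forall i, projective (C i),
          (forall i, degree_preserving (d i)) /\ degree_preserving aug,
          forall y, exists x, aug x = y &
          (forall x, aug x = 0 <-> exists y, d 0%N y = x) /\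
          (forall i x, d i x = 0 <-> exists y, d i.+1 y = x)].

Definition nonzero_entries (R : realType) n (u : 'rV[R]_n) : nat :=
  #|[set i | u 0 i != 0]|.

(* A class in R^n / V is given as a coset of V, and (R^n)^* is identified with
   R^n through the coordinate functionals. *)
Record polarized_arrangement (R : realType) (n k : nat) := PolarizedArrangement {
  pa_space : {vspace 'rV[R]_n};
  pa_eta : set 'rV[R]_n;
  pa_xi : 'Hom(subvs_of pa_space, R^o);
  pa_dim : \dim pa_space = k;
  pa_eta_coset : exists x0, pa_eta = [set x | x - x0 \in pa_space]%classic;
  pa_eta_generic : forall x, pa_eta x -> (n - k <= nonzero_entries x)%N;
  pa_xi_generic : forall a : 'rV[R]_n,
    (forall v : subvs_of pa_space, pa_xi v = \sum_i a 0 i * vsval v 0 i) ->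
    (k <= nonzero_entries a)%N
}.

(* true stands for the sign -1 *)
Definition sign_vector (n : nat) := {ffun 'I_n -> bool}.

Definition flip n (a : sign_vector n) (i : 'I_n) : sign_vector n :=
  [ffun j => a j (+) (j == i)].

Definition adjacent n : rel (sign_vector n) :=
  fun a b => #|[set i | a i != b i]| == 1%N.

Section Arrangement.
Variables (R : realType) (n k : nat) (V : polarized_arrangement R n k).
Implicit Types (a b : sign_vector n) (x : {set 'I_n}) (u : 'rV[R]_n).

Definition in_orthant a u : Prop := forall i, 0 <= (-1) ^+ a i * u 0 i.

(* V_eta is the coset pa_eta V itself. *)
Definition Delta a : set 'rV[R]_n := [set u | pa_eta V u /\ in_orthant a u]%classic.

Definition Sigma a : set (subvs_of (pa_space V)) :=
  [set v | in_orthant a (vsval v)]%classic.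

(* H_x *)
Definition flat x : set 'rV[R]_n :=
  [set u | pa_eta V u /\ forall i, i \in x -> u 0 i = 0]%classic.

Definition feasible : {set sign_vector n} := [set a | `[< Delta a !=set0 >]%classic].

Definition bounded_above : {set sign_vector n} :=
  [set a | `[< has_ubound (pa_xi V @` Sigma a) >]%classic].

Definition bounded_feasible : {set sign_vector n} := feasible :&: bounded_above.

Definition bases : {set {set 'I_n}} :=
  [set x : {set 'I_n} | (#|x| == k) && `[< flat x !=set0 >]%classic].

(* xi is only defined on V, so it is evaluated on differences of points of V_eta. *)
Definition attains_max a x : Prop :=
  exists u, [/\ flat x u, Delta a u &
    forall w, Delta a w -> pa_xi V (vsproj (pa_space V) (w - u)) <= 0].

(* The default values are never used on bases, resp. on bounded_feasible. *)
Definition mu x : sign_vector n :=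
  odflt [ffun=> false] [pick a in bounded_feasible | `[< attains_max a x >]].

Definition mu_inv a : {set 'I_n} := odflt finset.set0 [pick x in bases | mu x == a].

Definition feasible_cone x : {set sign_vector n} :=
  [set b : sign_vector n | [forall i, (i \notin x) ==> (b i == mu x i)]].

(* Z[t_1, ..., t_n]; monalg has a different {mpoly _[_]} *)
Local Notation Zt := (mpoly.mpoly n int).

(* The path algebra of the quiver tensored with Z[t_1, ..., t_n], as the path
   algebra over Z[t_1, ..., t_n]; its product is concatenation of paths read
   from left to right. *)
Definition path_alg := path_algebra Zt feasible (@adjacent n).

(* These are 0 when a vertex is not in feasible. *)
Definition vertex_idem a : path_alg := path_elt _ _ _ [:: a].
Definition arrow a b : path_alg := path_elt _ _ _ [:: a; b].

Inductive relator : path_alg -> Prop :=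
| relator_A1 a : a \in feasible :\: bounded_above -> relator (vertex_idem a)
| relator_A2 a b c d :
    {subset [:: a; b; c; d] <= feasible} -> uniq [:: a; b; c; d] ->
    cycle (@adjacent n) [:: a; b; c; d] ->
    relator (arrow a b * arrow b c - arrow a d * arrow d c)
| relator_A3 a b i : a \in feasible -> b \in feasible ->
    adjacent a b -> a i != b i ->
    relator (arrow a b * arrow b a - ('X_i : Zt) *: vertex_idem a).

Definition Atilde : pzRingType := ring_quot relator.

Definition path_alg_homogeneous (d : int) (f : path_alg) : Prop :=
  forall p m, mpoly.mcoeff m (monalg.mcoeff p f) != 0 ->
    d = ((mdeg m).*2 + (size (val p)).-1)%N%:Z.

Definition Atilde_homogeneous (d : int) (y : Atilde) : Prop :=
  exists2 f, path_alg_homogeneous d f & rq_pi relator f = y.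

Definition Ptilde a : graded_module Atilde :=
  @GradedModule Atilde (principal (rq_pi relator (vertex_idem a)))
    (fun d y => Atilde_homogeneous d (val y)).

Definition standard_relation a (y : Ptilde a) : Prop :=
  exists2 i, i \in mu_inv a & val y = rq_pi relator (arrow (flip a i) a).

Definition Vtilde a : graded_module Atilde :=
  @GradedModule Atilde (mod_quot (@standard_relation a))
    (fun d z => exists2 y, homogeneous d y & mq_pi (@standard_relation a) y = z).

End Arrangement.

(* Main.v *)
From HB Require Import structures.
Require Import Defs.
From mathcomp Require Import boolp classical_sets.
From mathcomp Require Import all_boot all_order all_algebra.
From mathcomp Require Import reals zify ring lra mpoly.

(**
The resolution is a cube.  Let x be the set of the k coordinates that vanish at
the point where a attains its maximum.  All sign vectors a^S obtained from a by
flipping the signs in a subset S of x are feasible, since they surround that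
point.  The term of degree p is the sum of the modules q^p P_(a^S) over the S
of size p with a^S bounded; when a^S is unbounded its idempotent is zero in the
algebra, so one may as well sum over all S.  The differential maps the summand
of S to the one of S minus l by right multiplication by the arrow from a^S to
its neighbour, with the signs of a cube.  The cokernel of its last map is V_a by
the definition of V_a (augment_kernel), so the point is exactness in positive
degrees (cube_boundary_exact).

Exactness is checked on a Z-basis of the algebra.  In an arrangement in general
position any two minimal galleries from b to c are related by passing across
squares (walls_connected, minimal_path_unique), hence every path from b to c
equals t^m times the minimal path p_bc, where m counts the pairs of opposite
crossings of each hyperplane (path_class_geodesic).  A monomial t^m p_bc dies
as soon as t^m is divisible by the monomial of a detour from b to c through an
unbounded chamber (class_through_unbounded), and these are the only relations:
the coefficients of the other monomials are well defined on the algebra, because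
detours multiply by a cocycle rule (tcoef_mul, geo_coef_ideal).  An element of
the algebra that ends at c is thus the same as the family of its integers
normal_coef (normal_coef_faithful, normal_coef_geo_sum).

For a fixed starting chamber b and a fixed multidegree M the complex becomes a
complex of integers, spanned by a family of subsets S of x (slice_boundary).  If
M contains a variable t_i with i in x, the family does not change when i is added
to S or removed from it, and it is acyclic.  Otherwise S runs over the subsets of
the set y of those i in x where b and a differ, and S belongs to the family if
and only if no v in V with xi v > 0 has the signs of b on D and on S, where D
only depends on b and M (unbounded_agreeP).  The other subsets of y form the
nerve of the half-spaces b_i v_i >= 0, for i in y, inside the convex set of the v
with xi v > 0 and the signs of b on D.  The half-spaces cover this set, because
xi v <= 0 whenever v has the signs of a on x (maximum_cone).  The nerve of a cover
of a convex set by convex sets is acyclic; for half-spaces this follows by cutting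
the convex set along the hyperplanes v_i = 0, one after the other
(confined_acyclic_in, slice_supp_acyclic).
*)

Set Implicit Arguments.
Unset Strict Implicit.
Unset Printing Implicit Defensive.

Import Order.TTheory GRing.Theory Num.Theory.

(** * Acyclic families of faces of a cube *)

Section Cube.
Local Open Scope ring_scope.
Variables (n : nat) (x : {set 'I_n}).
Implicit Types (S : {set 'I_n}) (A W : {set 'I_n} -> int) (F G : pred {set 'I_n}).

Definition below (l : 'I_n) S : nat := #|[set j in S | (j < l)%N]|.

Definition cube_sign l S : int := (-1) ^+ below l S.

Definition int_boundary A S : int := \sum_(l in x :\: S) cube_sign l S * A (l |: S).

Lemma below_setU1 l m S : m \notin S -> below l (m |: S) = ((m < l) + below l S)%N.
Proof.
move=> nmS; rewrite /below -!sum1dep_card.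
rewrite (bigID (pred1 m)) /=; congr (_ + _)%N.
  case: (boolP (m < l)%N) => ml.
    rewrite (big_pred1 m) // => j; rewrite !inE.
    by case: eqP => [->|]; rewrite ?ml ?andbF.
  rewrite big_pred0 // => j; rewrite !inE.
  by case: eqP => [->|]; rewrite ?(negPf ml) ?andbF.
apply: eq_bigl => j; rewrite !inE; case: eqP => [->|] //=; last by rewrite andbT.
by rewrite (negPf nmS) andbF.
Qed.

Lemma cube_sign_sq l S : cube_sign l S * cube_sign l S = 1.
Proof. by rewrite -expr2 sqrr_sign. Qed.

(** Removing l and m from a set in the two possible orders gives opposite signs. *)
Lemma cube_sign_swap l m S : l \notin S -> m \notin S -> l != m ->
  cube_sign l S * cube_sign m (l |: S) = - (cube_sign m S * cube_sign l (m |: S)).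
Proof.
move=> lS nmS lm; rewrite /cube_sign !below_setU1 //.
have : ((l < m) + (m < l) = 1)%N by move: lm; rewrite -val_eqE /=; case: ltngtP.
by case: (l < m)%N; case: (m < l)%N => //= _; rewrite ?add0n ?add1n ?exprS; ring.
Qed.

Lemma int_boundary_boundary A S : int_boundary (int_boundary A) S = 0.
Proof.
pose g l m := cube_sign l S * cube_sign m (l |: S) * A (m |: (l |: S)).
pose D := x :\: S.
have E : int_boundary (int_boundary A) S = \sum_(l in D) \sum_(m in D | m != l) g l m.
  apply: eq_bigr => l _; rewrite /int_boundary big_distrr /=.
  apply: eq_big => [m|m _]; last by rewrite mulrA.
  by rewrite !inE negb_or; do !case: (_ \in _); case: (m == l).
have E2 : \sum_(l in D) \sum_(m in D | m != l) g l m =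
          - \sum_(l in D) \sum_(m in D | m != l) g l m.
  rewrite {1}(exchange_big_dep (fun m => m \in D)) /=; last by move=> l m _ /andP[].
  rewrite -sumrN; apply: eq_bigr => m mD; rewrite -sumrN.
  apply: eq_big => [l|l]; first by rewrite mD eq_sym.
  move=> /andP[lD /andP[_ ml]]; rewrite /g.
  move: lD mD; rewrite !inE => /andP[lS _] /andP[nmS _].
  rewrite (cube_sign_swap lS nmS) 1?eq_sym // mulNr; congr (- (_ * A _)).
  by rewrite setUCA.
by rewrite E; move: E2; set X := BIG_F; lia.
Qed.

Definition supported F A := forall S, ~~ F S -> A S = 0.

Definition cut F A S : int := if F S then A S else 0.

Definition relative_cycle F A := supported F A /\ forall S, F S -> int_boundary A S = 0.

(** The cube modulo the faces outside F has no homology, in any degree. *)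
Definition acyclic F :=
  forall A, relative_cycle F A -> exists2 W, supported F W & forall S, F S -> int_boundary W S =
    A S.

Lemma supported_cut F A : supported F (cut F A).
Proof. by move=> S; rewrite /cut => /negPf->. Qed.

(** The family F is a product with the edge in direction i, which has no homology;
    the contraction W adds i to the faces that lack it. *)
Lemma acyclic_toggle F i : i \in x ->
  (forall S, i \notin S -> F (i |: S) = F S) -> acyclic F.
Proof.
move=> ix tog A [sA dA].
pose W S := if i \in S then cube_sign i (S :\ i) * A (S :\ i) else 0.
exists W => [S nF|S FS].
  rewrite /W; case: ifP => // iS; rewrite sA ?mulr0 //.
  by rewrite -tog ?setD11 // setD1K.
have [iS|iS] := boolP (i \in S); last first.
  rewrite /int_boundary (bigD1 i) ?inE ?iS //= big1 ?addr0.
    by rewrite /W setU11 setU1K // mulrA cube_sign_sq mul1r.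
  move=> l /andP[_ li]; rewrite /W !inE eq_sym (negPf li) (negPf iS) /=.
  by rewrite mulr0.
pose Q := S :\ i; have iQ : i \notin Q by rewrite setD11.
have SQ : S = i |: Q by rewrite setD1K.
have FQ : F Q by rewrite -tog // -SQ.
have := dA Q FQ; rewrite /int_boundary (bigD1 i) ?inE ?eqxx //= -SQ => /eqP.
rewrite addrC addr_eq0 => /eqP E.
have -> : A S = cube_sign i Q * (cube_sign i Q * A S).
  by rewrite mulrA cube_sign_sq mul1r.
rewrite -[_ * A S]opprK -E mulrN big_distrr /= -sumrN.
apply: eq_big => [l|l].
  rewrite SQ !inE; case: eqP => [->|] //=; rewrite ?andbF ?andbT //.
rewrite !inE => /andP[lS lx].
have lQ : l \notin Q by apply: contra lS; rewrite SQ !inE => ->; rewrite orbT.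
have li : l != i by apply: contraNneq lS => ->; rewrite SQ setU11.
rewrite /W inE iS orbT.
have -> : (l |: S) :\ i = l |: Q.
  apply/setP=> j; rewrite !inE; case: (j =P i) => [->|] //=.
  by rewrite eq_sym (negPf li).
have E3 := cube_sign_swap iQ lQ.
have E4 : cube_sign l (i |: Q) = - (cube_sign i Q * cube_sign l Q * cube_sign i (l |: Q)).
  by rewrite -mulrA -mulrN -E3 1?eq_sym // mulrA cube_sign_sq mul1r.
rewrite [in LHS]SQ E4 mulNr -!mulrA; congr (- (_ * (_ * _))).
by rewrite mulrA cube_sign_sq mul1r.
Qed.

(** For families closed under adding elements, the faces of G outside F span the
    kernel of the projection from the complex of G to the complex of F, so that the
    long exact sequence transfers acyclicity from G to F. *)
Lemma acyclic_sub F G :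
  (forall S l, l \in x -> G S -> G (l |: S)) ->
  (forall S l, l \in x -> F S -> F (l |: S)) ->
  (forall S, F S -> G S) ->
  acyclic (fun S => G S && ~~ F S) -> acyclic G -> acyclic F.
Proof.
move=> upG upF FG accD accG A [sA dA].
have sGA : supported G A by move=> S nG; apply: sA; apply: contra nG; apply: FG.
(* The boundary of A in G is supported outside F; correct A there to get a cycle of G. *)
pose H S := G S && ~~ F S.
have [|W sW dW] := accD (cut H (int_boundary A)).
  split; first exact: supported_cut.
  move=> S /andP[GS nFS]; rewrite -[RHS](int_boundary_boundary A S); apply: eq_bigr => l.
  rewrite inE => /andP[_ lx]; congr (_ * _); rewrite /cut /H upG //=.
  by case: ifP => // /negbFE FlS; rewrite dA.
have [|U sU dU] := accG (fun S => A S - W S).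
  split=> [S nG|S GS].
    by rewrite sGA // sW ?subr0 // negb_and nG.
  rewrite /int_boundary; under eq_bigr do rewrite mulrBr; rewrite sumrB -/(int_boundary A S)
    -/(int_boundary W S).
  have [FS|nFS] := boolP (F S).
    rewrite dA // sub0r /int_boundary big1 ?oppr0 // => l; rewrite inE => /andP[_ lx].
    by rewrite sW ?mulr0 // negb_and negbK upF ?orbT.
  have HS : H S by rewrite /H GS.
  by rewrite dW // /cut HS subrr.
exists (cut F U); first exact: supported_cut.
move=> S FS; have -> : A S = A S - W S by rewrite sW ?subr0 // negb_and negbK FS orbT.
rewrite -dU ?FG //; apply: eq_bigr => l.
by rewrite inE => /andP[_ lx]; rewrite /cut upF.
Qed.

End Cube.

(** * General position, galleries and walls *)

(** Walking from f to g along the segment between them, the indices that attain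
    the minimum change only at points where the old and the new one are both
    minimal.  From a minimal l that is not minimal at the end, the walk goes to the
    first crossing with some m such that g m < g l; as the values of g decrease along
    the walk, it ends. *)
Lemma lower_envelope_connected (R : realFieldType) (X : Type) (I : finType) (A : {set I})
    (f g : I -> R) (c : I -> X) (i j : I) :
  (forall t l m, (0 <= t <= 1)%R -> l \in A -> m \in A ->
     (forall p, p \in A -> (1 - t) * f l + t * g l <= (1 - t) * f p + t * g p)%R ->
     (forall p, p \in A -> (1 - t) * f m + t * g m <= (1 - t) * f p + t * g p)%R ->
     c l = c m) ->
  i \in A -> j \in A -> (forall p, p \in A -> f i <= f p)%R ->
  (forall p, p \in A -> g j <= g p)%R -> c i = c j.
Proof.
move=> glue iA jA fi gj.
suff claim N t l : (#|[set m in A | (g m < g l)%R]| < N)%N -> (0 <= t <= 1)%R -> l \in A ->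
    (forall p, p \in A -> (1 - t) * f l + t * g l <= (1 - t) * f p + t * g p)%R -> c l = c j.
  apply: (claim _ 0%R i (leqnn _)) => // [|p pA]; first by rewrite lexx ler01.
  by have := fi p pA; lra.
elim: N t l => // N IH t l cardN t01 lA minl.
pose D p := ((1 - t) * (f p - f l) + t * (g p - g l))%R.
pose ka p := (D p / (D p - (g p - g l)))%R.
have D0 p : p \in A -> (0 <= D p)%R by move=> /minl; rewrite /D; lra.
(* ka p is the fraction of the way from t to 1 at which p catches up with l. *)
have [m0 /andP[m0A m0l]|none] := pickP (fun m => (m \in A) && (g m < g l)%R); last first.
  apply: (glue 1%R); rewrite ?lexx ?ler01 // => p pA.
    by have := none p; rewrite pA /= => /negbT; rewrite -leNgt; lra.
  by have := gj p pA; lra.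
have [m /andP[mA ml] mmin] := @arg_minP _ _ _ m0 (fun m => (m \in A) && (g m < g l)%R) ka
  (introT andP (conj m0A m0l)).
have den p : p \in A -> (g p < g l)%R -> (0 < D p - (g p - g l))%R.
  by move=> pA pl; have := D0 p pA; lra.
have kam : (0 <= ka m < 1)%R.
  rewrite divr_ge0 ?D0 ?ltW ?den //= ltr_pdivrMr ?den // mul1r; lra.
pose s := (t + (1 - t) * ka m)%R.
have hs p : ((1 - s) * f p + s * g p - ((1 - s) * f l + s * g l) =
    D p - ka m * (D p - (g p - g l)))%R by rewrite /s /D; ring.
have hs0 p : p \in A -> (0 <= D p - ka m * (D p - (g p - g l)))%R.
  move=> pA; have [gp|gp] := ltP (g p) (g l).
    have := mmin p; rewrite pA gp => /(_ isT).
    by rewrite [X in (_ <= X)%R]/ka ler_pdivlMr ?den //; lra.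
  by have := D0 p pA; nra.
have hsm : (D m - ka m * (D m - (g m - g l)) = 0)%R.
  by rewrite /ka divfK ?subrr // gt_eqF ?den.
have s01 : (0 <= s <= 1)%R by rewrite /s; apply/andP; split; nra.
have minm p : p \in A -> ((1 - s) * f m + s * g m <= (1 - s) * f p + s * g p)%R.
  by move=> pA; have := hs p; have := hs m; have := hs0 p pA; rewrite hsm; lra.
rewrite (glue s l m) //; last by move=> p pA; have := hs p; have := hs0 p pA; lra.
apply: (IH s) => //; apply: leq_trans (_ : #|[set p in A | (g p < g l)%R]| <= N)%N => //.
apply: proper_card; apply/properP; split.
  by apply/subsetP=> p; rewrite !inE => /andP[-> /lt_trans->].
by exists m; rewrite !inE mA ?ml ?ltxx.
Qed.

Section Geometry.
Local Open Scope ring_scope.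
Variables (R : realType) (n k : nat) (V : polarized_arrangement R n k).
Implicit Types (a b c : sign_vector n) (u v w : 'rV[R]_n) (i j l m : 'I_n)
  (Z x : {set 'I_n}).

Local Notation Vs := (pa_space V).
Local Notation E := (pa_eta V).

(** xi extended from V to the whole space through a projection, so as to apply to
    plain vectors. *)
Definition xi v : R := pa_xi V (vsproj Vs v).

Lemma xiD v w : xi (v + w) = xi v + xi w.
Proof. by rewrite /xi !linearD. Qed.

Lemma xiZ r v : xi (r *: v) = r * xi v.
Proof. by rewrite /xi !linearZ. Qed.

Lemma xi0 : xi 0 = 0.
Proof. by rewrite /xi !linear0. Qed.

Lemma xiN v : xi (- v) = - xi v.
Proof. by rewrite /xi !linearN. Qed.

Lemma xi_sum (I : finType) (F : I -> 'rV[R]_n) : xi (\sum_i F i) = \sum_i xi (F i).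
Proof. by apply: (big_morph xi xiD xi0). Qed.

Definition scoord b i u : R := (-1) ^+ b i * u 0 i.

Lemma scoordD b i u w : scoord b i (u + w) = scoord b i u + scoord b i w.
Proof. by rewrite /scoord mxE mulrDr. Qed.

Lemma scoordZ b i r u : scoord b i (r *: u) = r * scoord b i u.
Proof. by rewrite /scoord mxE mulrCA. Qed.

Lemma scoord_eq0 b i u : (scoord b i u == 0) = (u 0 i == 0).
Proof. by rewrite /scoord mulf_eq0 signr_eq0. Qed.

Lemma scoord_neq b c i u : b i != c i -> scoord c i u = - scoord b i u.
Proof.
by rewrite /scoord; case: (b i); case: (c i) => //= _; rewrite ?expr1 ?expr0; ring.
Qed.

Lemma scoord_eq b c i u : b i = c i -> scoord c i u = scoord b i u.
Proof. by rewrite /scoord => ->. Qed.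

Lemma eta_add u v : E u -> v \in Vs -> E (u + v).
Proof.
have [x0 ->] /= := pa_eta_coset V => ux vV.
by rewrite addrAC rpredD.
Qed.

Lemma eta_sub u w : E u -> E w -> w - u \in Vs.
Proof.
have [x0 ->] /= := pa_eta_coset V => ux wx.
by rewrite -(subrK x0 w) -addrA -[x0 - u]opprB rpredB.
Qed.

Lemma eta_convex t u w : E u -> E w -> E ((1 - t) *: u + t *: w).
Proof.
move=> Eu Ew; have -> : (1 - t) *: u + t *: w = u + t *: (w - u).
  by rewrite scalerBl scale1r scalerBr -!addrA; congr (_ + _); rewrite addrC.
by apply: eta_add => //; rewrite rpredZ // eta_sub.
Qed.

Lemma rV_neq0 u : u != 0 -> exists j, u 0 j != 0.
Proof.
move=> nu; apply/existsP; rewrite -negb_forall; apply: contra nu => /forallP u0.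
by apply/eqP/rowP=> j; rewrite mxE; apply/eqP.
Qed.

(** While W is not zero, u can be moved along W until a further coordinate vanishes,
    at the cost of one dimension of W.  Once W is zero, the genericity of eta bounds
    the number of vanishing coordinates of u. *)
Lemma zeros_dim_bound u Z (W : {vspace 'rV[R]_n}) :
  E u -> (forall i, i \in Z -> u 0 i = 0) -> (W <= Vs)%VS ->
  (forall w, w \in W -> forall i, i \in Z -> w 0 i = 0) ->
  (#|Z| + \dim W <= k)%N.
Proof.
have [d] := ubnP (\dim W); elim: d u Z W => // d IH u Z W Wd Eu uZ WV WZ.
have [/eqP W0|W0] := boolP (W == 0%VS).
  have lek : (k <= n)%N.
    by rewrite -(pa_dim V) (leq_trans (dimvS (subvf _))) // dimvf /dim /= mul1n.
  rewrite W0 dimv0 addn0; have := pa_eta_generic Eu; rewrite /nonzero_entries.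
  set N := [set i | _]; have disj : Z :&: N = set0.
    by apply/setP=> i; rewrite !inE; case: (boolP (i \in Z)) => // /uZ ->; rewrite eqxx.
  have := cardsUI Z N; rewrite disj cards0 addn0.
  have : (#|Z :|: N| <= n)%N by rewrite -[X in (_ <= X)%N]card_ord max_card.
  move: #|Z :|: N| #|Z| #|N| lek => p q r; clear; lia.
have vW := memv_pick W; have /rV_neq0[j vj] : vpick W != 0 by rewrite vpick0.
set v := vpick W in vW vj.
have jZ : j \notin Z by apply: contra vj => jZ; rewrite (WZ v).
pose f : 'Hom('rV[R]_n, 'M[R]_(1, 1)) := linfun (mulmxr (delta_mx j 0 : 'cV[R]_n)).
have fE w : f w 0 0 = w 0 j by rewrite lfunE /= -colE mxE.
have fW : (\dim (f @: W) <= 1)%N.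
  by rewrite (leq_trans (dimvS (subvf _))) // dimvf /dim /= muln1.
have dW := limg_ker_dim f W.
pose W' := (W :&: lker f)%VS.
have vW' : v \notin W'.
  rewrite memv_cap vW /= memv_ker; apply: contra vj => /eqP fv.
  by rewrite -fE fv mxE.
have ltW : (\dim W' < \dim W)%N.
  rewrite ltn_neqAle dimvS ?capvSl // andbT; apply: contra vW' => /eqP e.
  by rewrite (_ : W' = W) //; apply/eqP; rewrite eqEdim capvSl e leqnn.
have : (#|j |: Z| + \dim W' <= k)%N.
  apply: (IH (u - (u 0 j / v 0 j) *: v)).
  - exact: leq_trans ltW _.
  - by apply: eta_add => //; rewrite rpredN rpredZ // (subvP WV).
  - move=> i; rewrite !mxE in_setU1 => /orP[/eqP->|iZ]; first by rewrite divfK ?subrr.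
    by rewrite (uZ i iZ) (WZ v vW i iZ) mulr0 subr0.
  - exact: subv_trans (capvSl _ _) WV.
  - move=> w; rewrite memv_cap memv_ker => /andP[wW /eqP fw] i.
    rewrite in_setU1 => /orP[/eqP->|]; last exact: WZ.
    by rewrite -fE fw mxE.
rewrite cardsU1 jZ -dW -/W'; move: #|Z| (\dim W') (\dim (f @: W)) fW => p q r; clear; lia.
Qed.

Definition restriction_map Z : 'Hom('rV[R]_n, 'rV[R]_#|Z|) :=
  linfun (mulmxr (\matrix_(i, j) (i == enum_val j)%:R)).

Lemma restriction_mapE Z w (j : 'I_#|Z|) : restriction_map Z w 0 j = w 0 (enum_val j).
Proof.
rewrite lfunE /= mxE (bigD1 (enum_val j)) //= mxE eqxx mulr1 big1 ?addr0 // => i.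
by rewrite mxE => /negPf->; rewrite mulr0.
Qed.

Lemma restriction_map0 Z w i : restriction_map Z w = 0 -> i \in Z -> w 0 i = 0.
Proof. by move=> w0 iZ; rewrite -(enum_rankK_in iZ iZ) -restriction_mapE w0 mxE. Qed.

(** The arrangement is simple: the coordinates that vanish at a point of V_eta are
    independent on V.  By zeros_dim_bound their common kernel in V has codimension
    at least their number. *)
Lemma zeros_surjective u Z (c : 'I_n -> R) : E u -> (forall i, i \in Z -> u 0 i = 0) ->
  exists2 v, v \in Vs & forall i, i \in Z -> v 0 i = c i.
Proof.
move=> Eu uZ; have dW := limg_ker_dim (restriction_map Z) Vs.
have dK : (#|Z| + \dim (Vs :&: lker (restriction_map Z)) <= k)%N.
  apply: (zeros_dim_bound Eu uZ); first exact: capvSl.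
  move=> w; rewrite memv_cap memv_ker => /andP[_ /eqP fw] i; exact: restriction_map0.
have full : (restriction_map Z @: Vs)%VS = fullv.
  apply/eqP; rewrite eqEdim subvf dimvf /dim /= mul1n.
  by rewrite -(leq_add2l (\dim (Vs :&: lker (restriction_map Z)))) dW pa_dim addnC.
have : (\row_j c (enum_val j)) \in (restriction_map Z @: Vs)%VS by rewrite full memvf.
case/memv_imgP => v vV e; exists v => // i iZ.
by rewrite -(enum_rankK_in iZ iZ) -restriction_mapE -e mxE.
Qed.

Lemma vanishing_direction Z : (#|Z| < k)%N ->
  exists2 v, v \in Vs & v != 0 /\ forall i, i \in Z -> v 0 i = 0.
Proof.
move=> Zk; pose W := (Vs :&: lker (restriction_map Z))%VS; exists (vpick W).
  by have := memv_pick W; rewrite memv_cap => /andP[].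
have : vpick W \in lker (restriction_map Z) by have := memv_pick W; rewrite memv_cap => /andP[].
rewrite memv_ker => /eqP W0; split; last by move=> i; apply: restriction_map0.
rewrite vpick0 -dimv_eq0 -lt0n; have := limg_ker_dim (restriction_map Z) Vs; rewrite -/W pa_dim.
have : (\dim (restriction_map Z @: Vs) <= #|Z|)%N.
  by rewrite (leq_trans (dimvS (subvf _))) // dimvf /dim /= mul1n.
by move: (\dim W) (\dim _) Zk => p q; clear; move: #|Z| => r; lia.
Qed.

Lemma small_step (f g : 'I_n -> R) : exists2 e, 0 < e & forall i, 0 < f i -> e * `|g i| < f i.
Proof.
pose s := \sum_i `|g i| / `|f i|.
have t0 i : 0 <= `|g i| / `|f i| by rewrite divr_ge0.
have s0 : 0 <= s by rewrite sumr_ge0.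
have s1 : 0 < 1 + s by lra.
exists (1 + s)^-1; first by rewrite invr_gt0.
move=> i fi; rewrite mulrC ltr_pdivrMr // mulrC -ltr_pdivrMr //.
have : `|g i| / f i <= s.
  by rewrite /s (bigD1 i) //= (gtr0_norm fi) lerDl sumr_ge0.
lra.
Qed.

(** As the vanishing coordinates of u are independent on V, a small displacement
    gives them arbitrary signs. *)
Lemma perturb_strict b u : E u -> (forall i, u 0 i != 0 -> 0 <= scoord b i u) ->
  exists2 w, E w & forall i, 0 < scoord b i w.
Proof.
move=> Eu ub; pose Z := [set i | u 0 i == 0].
have [|v vV vZ] := @zeros_surjective u Z (fun i => (-1) ^+ b i) Eu.
  by move=> i; rewrite inE => /eqP.
have [e e0 small] := small_step (fun i => scoord b i u) (fun i => scoord b i v).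
exists (u + e *: v) => [|i]; first by apply: eta_add => //; rewrite rpredZ.
rewrite scoordD scoordZ; have [ui|ui] := boolP (u 0 i == 0).
  by rewrite {1 2}/scoord vZ ?inE // (eqP ui) mulr0 add0r -expr2 sqrr_sign mulr1.
have lt : 0 < scoord b i u by rewrite lt_neqAle ub // andbT eq_sym scoord_eq0.
have := small i lt; have := ler_norm (- scoord b i v); rewrite normrN; nra.
Qed.

Lemma feasibleP b : reflect (exists2 u, E u & forall i, 0 <= scoord b i u) (b \in feasible V).
Proof. by rewrite inE; apply: (iffP (asboolP _)) => [[u [Eu ub]]|[u Eu ub]]; exists u. Qed.

Lemma feasible_strict b : b \in feasible V -> exists2 u, E u & forall i, 0 < scoord b i u.
Proof. by case/feasibleP=> u Eu ub; apply: (@perturb_strict b u). Qed.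

(** All the chambers around a point of V_eta are present, as the arrangement is simple. *)
Lemma feasible_near b u : E u -> (forall i, u 0 i != 0 -> 0 <= scoord b i u) -> b \in feasible V.
Proof.
by move=> Eu /(perturb_strict Eu)[w Ew wb]; apply/feasibleP; exists w => // i; apply/ltW.
Qed.


Definition sep b c : {set 'I_n} := [set i | b i != c i].

Lemma flipE b i l : flip b i l = b l (+) (l == i).
Proof. by rewrite ffunE. Qed.

Lemma flip_neq b i l : l != i -> flip b i l = b l.
Proof. by rewrite flipE => /negPf->; rewrite addbF. Qed.

(** On the segment from p to v, the chamber of b is left at the point q where the
    smallest of the ratios of signed coordinates is reached.  The walls i and j both
    pass through q, so all the chambers around q, and in particular the neighbours of
    b across i, and then across j, are feasible. *)
Lemma exit_walls b c p v i j : E p -> E v ->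
  (forall l, 0 <= scoord b l p) -> (forall l, b l = c l -> 0 < scoord b l p) ->
  (forall l, 0 < scoord c l v) -> i \in sep b c -> j \in sep b c ->
  (forall l, l \in sep b c -> scoord b i p / scoord c i v <= scoord b l p / scoord c l v) ->
  (forall l, l \in sep b c -> scoord b j p / scoord c j v <= scoord b l p / scoord c l v) ->
  flip b i \in feasible V /\ flip (flip b i) j \in feasible V.
Proof.
move=> Ep Ev p0 p1 v0 iA jA mini minj.
pose rho := scoord b i p / scoord c i v.
have rhoj : rho = scoord b j p / scoord c j v by apply/le_anti; rewrite mini // minj.
have rho0 : 0 <= rho by rewrite divr_ge0 // ltW.
have rho1 : 0 < 1 + rho by lra.
(* The ratio rho is the one of the lengths of the two parts of the segment cut by q. *)
pose t := rho / (1 + rho); pose q := (1 - t) *: p + t *: v.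
have Eq : E q by apply: eta_convex.
have qE l : scoord b l q = (1 + rho)^-1 * (scoord b l p + rho * scoord b l v).
  rewrite scoordD !scoordZ /t; field; lra.
have inv0 : 0 < (1 + rho)^-1 by rewrite invr_gt0.
have q0 l : 0 <= scoord b l q.
  rewrite qE; apply: mulr_ge0; first exact: ltW.
  have [e|ne] := eqVneq (b l) (c l).
    by have := p1 l e; rewrite -(scoord_eq v e); have := v0 l; rewrite (scoord_eq v e); nra.
  have := mini l; rewrite inE ne => /(_ isT).
  by rewrite -/rho ler_pdivlMr // (scoord_neq v ne); lra.
have qz l : l \in sep b c -> rho = scoord b l p / scoord c l v -> q 0 l == 0.
  rewrite inE => ne e; rewrite -(scoord_eq0 b) qE.
  have -> : scoord b l p = rho * scoord c l v by rewrite e divfK // gt_eqF.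
  by rewrite (scoord_neq v ne) mulrN addNr mulr0.
have qi := qz i iA erefl; have qj := qz j jA rhoj.
split; apply: (feasible_near Eq) => l ql.
  by rewrite (@scoord_eq b) // flip_neq //; apply: contraNneq ql => ->.
by rewrite (@scoord_eq b) // !flip_neq //; apply: contraNneq ql => ->.
Qed.

(** A segment from the interior of one chamber to the interior of the other leaves the
    first one through a wall that separates them. *)
Lemma feasible_step b c : b \in feasible V -> c \in feasible V -> b != c ->
  exists2 i, i \in sep b c & flip b i \in feasible V.
Proof.
move=> /feasible_strict[u Eu ub] /feasible_strict[v Ev vc] bc.
have [i0 i0A] : exists i, i \in sep b c.
  have [e|[i iA]] := set_0Vmem (sep b c); last by exists i.
  case/eqP: bc; apply/ffunP=> i; apply/eqP.
  have : i \notin sep b c by rewrite e inE.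
  by rewrite inE negbK.
have [i iA imin] := @arg_minP _ _ _ i0 (mem (sep b c)) (fun l => scoord b l u / scoord c l v) i0A.
exists i => //.
have [] // := @exit_walls b c u v i i Eu Ev _ _ vc iA iA imin imin.
by move=> l; apply: ltW.
Qed.

Lemma facet_point b i : b \in feasible V -> flip b i \in feasible V ->
  exists2 p, E p & scoord b i p = 0 /\ forall l, l != i -> 0 < scoord b l p.
Proof.
move=> /feasible_strict[u Eu ub] /feasible_strict[w Ew wb].
have wi : scoord b i w < 0.
  have := wb i; rewrite (@scoord_neq b) ?flipE ?eqxx ?oppr_gt0 //.
  by case: (b i).
have ui := ub i; pose t := scoord b i u / (scoord b i u - scoord b i w).
have den : 0 < scoord b i u - scoord b i w by lra.
have tt : t * (scoord b i u - scoord b i w) = scoord b i u by rewrite divfK // gt_eqF.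
have t0 : 0 <= t by rewrite divr_ge0 // ltW.
have t1 : t < 1 by rewrite ltr_pdivrMr // mul1r; lra.
exists ((1 - t) *: u + t *: w); first exact: eta_convex.
split=> [|l li]; rewrite scoordD !scoordZ; first by lra.
by have := wb l; rewrite (@scoord_eq b) ?flip_neq //; have := ub l; nra.
Qed.

(** The point at which the segment from a point of the chamber of b towards v leaves
    that chamber lies on wall i when it starts on the facet i, and on wall j when it
    starts on the facet j.  While the starting point moves from one facet to the other,
    the exit wall changes only at points common to the old and the new wall, where
    the two walls and b span a square of feasible chambers. *)
Lemma walls_connected (X : Type) (cc : 'I_n -> X) b c i j :
  b \in feasible V -> c \in feasible V ->
  (forall l m, l \in sep b c -> m \in sep b c -> l != m ->
     flip b l \in feasible V -> flip b m \in feasible V ->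
     flip (flip b l) m \in feasible V -> cc l = cc m) ->
  i \in sep b c -> j \in sep b c -> flip b i \in feasible V -> flip b j \in feasible V ->
  cc i = cc j.
Proof.
move=> bF cF glue iA jA biF bjF.
have [p Ep [pi0 pb]] := facet_point bF biF; have [q Eq [qj0 qb]] := facet_point bF bjF.
have [v Ev vc] := feasible_strict cF.
have p0 l : 0 <= scoord b l p by have [->|/pb/ltW] := eqVneq l i; rewrite ?pi0.
have q0 l : 0 <= scoord b l q by have [->|/qb/ltW] := eqVneq l j; rewrite ?qj0.
apply: (@lower_envelope_connected _ _ _ (sep b c) (fun l => scoord b l p / scoord c l v)
  (fun l => scoord b l q / scoord c l v)) => //; first last.
- by move=> l _; rewrite qj0 mul0r divr_ge0 // ltW.
- by move=> l _; rewrite pi0 mul0r divr_ge0 // ltW.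
move=> t l m t01 lA mA minl minm.
have [->//|lm] := eqVneq l m.
pose s := (1 - t) *: p + t *: q.
have Es : E s by apply: eta_convex.
have sE d : scoord b d s / scoord c d v = (1 - t) * (scoord b d p / scoord c d v) + t
  * (scoord b d q / scoord c d v).
  by rewrite scoordD !scoordZ mulrDl !mulrA.
have s0 d : 0 <= scoord b d s by rewrite scoordD !scoordZ; have := p0 d; have := q0 d; nra.
have s1 d : b d = c d -> 0 < scoord b d s.
  move=> e; have di : d != i by apply: contraTneq iA => <-; rewrite inE e eqxx.
  have dj : d != j by apply: contraTneq jA => <-; rewrite inE e eqxx.
  by rewrite scoordD !scoordZ; have := pb d di; have := qb d dj; nra.
have minl' d : d \in sep b c -> scoord b l s / scoord c l v <= scoord b d s / scoord c d v.
  by move=> dA; rewrite !sE minl.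
have minm' d : d \in sep b c -> scoord b m s / scoord c m v <= scoord b d s / scoord c d v.
  by move=> dA; rewrite !sE minm.
have [blF blmF] := exit_walls Es Ev s0 s1 vc lA mA minl' minm'.
have [bmF _] := exit_walls Es Ev s0 s1 vc mA lA minm' minl'.
exact: glue.
Qed.

Lemma not_boundedP b : reflect (exists2 v, v \in Vs & 0 < xi v /\ forall i, 0 <= scoord b i v)
  (b \notin bounded_above V).
Proof.
rewrite inE; apply: (iffP negP) => [nb|[v vV [v0 vb]] /asboolP[m ub]].
  apply: contrapT => no; apply: nb; apply/asboolP; exists 0 => _ [y yS <-].
  rewrite leNgt; apply/negP=> y0; apply: no; exists (vsval y); first exact: subvsP.
  by split=> //; rewrite /xi vsvalK.
pose y := vsproj Vs (((`|m| + 1) / xi v) *: v).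
have rv : 0 <= (`|m| + 1) / xi v by rewrite divr_ge0 ?addr_ge0 // ltW.
have : pa_xi V y <= m.
  apply: ub; exists y => // i; rewrite vsprojK ?rpredZ //.
  by rewrite -/(scoord b i _) scoordZ mulr_ge0.
rewrite -/(xi _) xiZ divfK ?gt_eqF //; have := ler_norm m; lra.
Qed.

(** A direction v that increases xi and has the signs of b on D leads, from an interior
    point of the chamber of b, into an unbounded chamber that agrees with b on D. *)
Lemma unbounded_agreeP b (D : {set 'I_n}) : b \in feasible V ->
  (exists2 c, c \in feasible V :\: bounded_above V & forall i, i \in D -> c i = b i) <->
  (exists2 v, v \in Vs & 0 < xi v /\ forall i, i \in D -> 0 <= scoord b i v).
Proof.
move=> bF; split=> [[c]|[v vV [v0 vb]]].
  rewrite inE => /andP[/not_boundedP[v vV [v0 vc]] _] cb; exists v => //; split=> // i iD.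
  by rewrite (scoord_eq v (cb i iD)).
have [u Eu ub] := feasible_strict bF.
(* c is the chamber reached from u in the direction v; v itself shows that it is unbounded. *)
pose c : sign_vector n := [ffun i => if v 0 i == 0 then b i else v 0 i < 0].
have cv i : scoord c i v = `|v 0 i|.
  rewrite /scoord ffunE; have [->|vi] := eqVneq (v 0 i) 0; first by rewrite mulr0 normr0.
  by rewrite {2}[v 0 i]numEsign mulrA -expr2 sqrr_sign mul1r.
exists c => [|i iD].
  rewrite inE; apply/andP; split.
    by apply/not_boundedP; exists v => //; split=> // i; rewrite cv.
  pose s := \sum_i `|u 0 i| / `|v 0 i|.
  have s0 : 0 <= s by apply: sumr_ge0 => i _; rewrite divr_ge0.
  apply/feasibleP; exists (u + s *: v); first by apply: eta_add => //; rewrite rpredZ.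
  move=> i; rewrite scoordD scoordZ cv; have [vi|vi] := eqVneq (v 0 i) 0.
    by rewrite (@scoord_eq b) ?ffunE ?vi ?eqxx // normr0 mulr0 addr0 ltW.
  have v1 : 0 < `|v 0 i| by rewrite normr_gt0.
  have : `|u 0 i| / `|v 0 i| <= s.
    by rewrite /s (bigD1 i) //= lerDl sumr_ge0 // => j _; rewrite divr_ge0.
  rewrite ler_pdivrMr //; have : - `|u 0 i| <= scoord c i u; last by lra.
  by rewrite /scoord lerNl -mulNr; case: (c i); rewrite ?expr1 ?expr0 ?opprK ?mulN1r ?mul1r;
     rewrite ?ler_norm // -normrN ler_norm.
rewrite ffunE; have [//|vi] := eqVneq (v 0 i) 0.
have := vb i iD; rewrite /scoord; case: (b i); rewrite ?expr1 ?expr0 ?mulN1r ?mul1r ?oppr_ge0.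
  by rewrite lt_neqAle vi.
by rewrite leNgt => /negPf.
Qed.

Section Vertex.
Variables (x : {set 'I_n}) (u : 'rV[R]_n).
Hypotheses (xk : #|x| = k) (xu : flat V x u).

Lemma vertex_neq0 i : i \notin x -> u 0 i != 0.
Proof.
have [Eu ux] := xu; move=> ix; apply/negP=> /eqP ui.
have : (#|i |: x| + \dim (0%VS : {vspace 'rV[R]_n}) <= k)%N.
  apply: (zeros_dim_bound Eu) => [j||w]; rewrite ?sub0v //.
    by rewrite in_setU1 => /orP[/eqP->|/ux].
  by rewrite memv0 => /eqP-> j _; rewrite mxE.
by rewrite dimv0 addn0 cardsU1 ix xk add1n ltnn.
Qed.

Lemma vertex_inj v : v \in Vs -> (forall i, i \in x -> v 0 i = 0) -> v = 0.
Proof.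
have [Eu ux] := xu; move=> vV v0.
suff : (\dim <[v]> <= 0)%N by rewrite dim_vline; case: eqP.
rewrite -(leq_add2l #|x|) addn0 {2}xk; apply: (zeros_dim_bound Eu ux).
  by rewrite -memvE.
by move=> w /vlineP[r ->] i ix; rewrite mxE v0 ?mulr0.
Qed.

Lemma vertex_dual : exists2 d : 'I_n -> 'rV[R]_n, forall i, d i \in Vs &
  (forall i j, i \in x -> j \in x -> d i 0 j = (j == i)%:R) /\
  (forall v, v \in Vs -> xi v = \sum_(i in x) v 0 i * xi (d i)).
Proof.
have [Eu ux] := xu.
have ex i : exists v, v \in Vs /\ (forall j, j \in x -> v 0 j = (j == i)%:R).
  by have [v vV vx] := @zeros_surjective u x (fun j => (j == i)%:R) Eu ux; exists v.
have [d dP] := choice ex; exists d => [i|]; first by have [] := dP i.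
split=> [i j _|v vV]; first by have [_] := dP i; apply.
have -> : v = \sum_i (if i \in x then v 0 i *: d i else 0).
  apply/eqP; rewrite -subr_eq0; apply/eqP; apply: vertex_inj => [|j jx].
    rewrite rpredB // rpred_sum // => i _; case: ifP => _; rewrite ?rpred0 //.
    by rewrite rpredZ //; have [] := dP i.
  rewrite !mxE summxE (bigD1 j) //= jx mxE; have [_ ->//] := dP j.
  rewrite eqxx mulr1 big1 ?addr0 ?subrr // => i ij; case: ifP => ix; rewrite !mxE //.
  by have [_ ->//] := dP i; rewrite eq_sym (negPf ij) mulr0.
rewrite xi_sum [RHS]big_mkcond; apply: eq_bigr => i _; case: ifP => ix; rewrite ?xi0 //.
rewrite xiZ summxE (bigD1 i) //= ix mxE; have [_ ->//] := dP i.
rewrite eqxx mulr1 big1 ?addr0 // => j ji; case: ifP => jx; rewrite !mxE //.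
by have [_ ->//] := dP j; rewrite eq_sym (negPf ji) mulr0.
Qed.

(** Otherwise the expansion of xi in the coordinates indexed by x would be a lift of xi
    with fewer than k nonzero entries. *)
Lemma vertex_dual_neq0 (d : 'I_n -> 'rV[R]_n) :
  (forall v, v \in Vs -> xi v = \sum_(i in x) v 0 i * xi (d i)) ->
  forall i, i \in x -> xi (d i) != 0.
Proof.
move=> dE i ix.
pose r : 'rV[R]_n := \row_i (if i \in x then xi (d i) else 0).
have le : (k <= nonzero_entries r)%N.
  apply: (@pa_xi_generic _ _ _ V) => y; rewrite -[y]vsvalK -/(xi _) dE ?subvsP //.
  rewrite big_mkcond; apply: eq_bigr => j _; rewrite mxE vsvalK; case: ifP; rewrite ?mul0r //.
  by rewrite mulrC.
have sub : [set j | r 0%R j != 0%R] \subset x.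
  by apply/subsetP=> j; rewrite !inE mxE; case: ifP => //; rewrite eqxx.
have /eqP e : [set j | r 0%R j != 0%R] == x by rewrite eqEcard sub xk.
by move: ix; rewrite -{1}e inE mxE; case: ifP => //; rewrite eqxx.
Qed.

End Vertex.

End Geometry.

(** * Vertices and maxima *)

Section Vertices.
Local Open Scope ring_scope.
Variables (R : realType) (n k : nat) (V : polarized_arrangement R n k).
Implicit Types (a b c : sign_vector n) (u v w : 'rV[R]_n) (i j l m : 'I_n)
  (Z x : {set 'I_n}).

Local Notation Vs := (pa_space V).
Local Notation E := (pa_eta V).
Local Notation xi := (xi V).

Lemma basesP x : reflect (#|x| = k /\ exists u, flat V x u) (x \in bases V).
Proof.
rewrite inE; apply: (iffP andP) => [[/eqP-> /asboolP[u ux]]|[-> [u ux]]]; last first.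
  by rewrite eqxx; split=> //; apply/asboolP; exists u.
by split=> //; exists u.
Qed.

(** Since xi is bounded on the cone of a, a direction along which xi does not decrease
    can be chosen to leave the chamber of a. *)
Lemma bounded_direction a v : a \in bounded_above V -> v \in Vs -> v != 0 ->
  exists r, 0 <= r * xi v /\ exists i, r * scoord a i v < 0.
Proof.
move=> aB vV v0.
have key w : w \in Vs -> 0 < xi w -> exists i, scoord a i w < 0.
  move=> wV xw; apply: contrapT => no; move: aB; apply/negP/not_boundedP.
  exists w => //; split=> // i; rewrite leNgt; apply/negP=> h; apply: no; by exists i.
have [xv|xv|xv] := ltgtP 0 (xi v).
- by have [i iv] := key v vV xv; exists 1; rewrite mul1r ltW //; split=> //; exists i;
  rewrite mul1r.
- have [||i iv] := key (- v); rewrite ?rpredN ?xiN ?oppr_gt0 //.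
  exists (-1); rewrite mulN1r oppr_ge0 ltW //; split=> //; exists i.
  by rewrite -[_ * _](scoordZ a i) scaleN1r.
have [i vi] := rV_neq0 v0; rewrite -xv.
have : scoord a i v != 0 by rewrite scoord_eq0.
rewrite neq_lt => /orP[h|h]; [exists 1|exists (-1)]; rewrite mulr0 lexx; split=> //; exists i.
  by rewrite mul1r.
by rewrite mulN1r oppr_lt0.
Qed.

(** Linear programming: as long as fewer than k coordinates vanish, there is a direction
    in V that keeps them zero and does not decrease xi; following it up to the first wall
    of the chamber makes one more coordinate vanish. *)
Lemma ascend_to_vertex a u : a \in bounded_above V -> Delta V a u ->
  exists x w, [/\ #|x| = k, flat V x w, Delta V a w & 0 <= xi (w - u)].
Proof.
move=> aB; pose Z u : {set 'I_n} := [set i | u 0 i == 0].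
have [d] := ubnP (n - #|Z u|)%N; elim: d u => // d IH u Zd [Eu ua].
have uZ i : i \in Z u -> u 0 i = 0 by rewrite inE => /eqP.
have Zk : (#|Z u| <= k)%N.
  have := @zeros_dim_bound _ _ _ V u (Z u) 0%VS Eu uZ (sub0v _).
  by rewrite dimv0 addn0; apply=> w; rewrite memv0 => /eqP-> i _; rewrite mxE.
have [eZ|ltZ] := eqVneq #|Z u| k.
  by exists (Z u), u; split=> //; rewrite subrr xi0.
have [|v0 v0V [v0n v0Z]] := @vanishing_direction _ _ _ V (Z u).
  by rewrite ltn_neqAle ltZ.
have [r [xr [i0 ri0]]] := bounded_direction aB v0V v0n.
pose v := r *: v0.
have vV : v \in Vs by rewrite rpredZ.
have vZ i : i \in Z u -> v 0 i = 0 by move=> iZ; rewrite mxE v0Z ?mulr0.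
have i0v : scoord a i0 v < 0 by rewrite scoordZ.
have xv : 0 <= xi v by rewrite xiZ.
pose ka i := scoord a i u / - scoord a i v.
have [i iv imin] := @arg_minP _ _ _ i0 (fun i => scoord a i v < 0) ka i0v.
have ka0 : 0 <= ka i by apply: divr_ge0; [exact: ua | rewrite oppr_ge0 ltW].
pose w := u + ka i *: v.
have Ew : E w by apply: eta_add => //; rewrite rpredZ.
have wa j : 0 <= scoord a j w.
  rewrite scoordD scoordZ; have uaj : 0 <= scoord a j u := ua j.
  have [jv|jv] := ltP (scoord a j v) 0; last by have := mulr_ge0 ka0 jv; lra.
  have := imin j jv; rewrite [X in _ <= X -> _]/ka ler_pdivlMr ?oppr_gt0 //; lra.
have wi : scoord a i w = 0.
  rewrite scoordD scoordZ /ka invrN mulrN mulNr divfK ?subrr // lt_eqF //.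
have sub : Z u \proper Z w.
  apply/properP; split.
    by apply/subsetP=> j jZ; rewrite inE mxE uZ // mxE vZ // mulr0 addr0.
  exists i; first by rewrite inE -(scoord_eq0 a) wi.
  by apply: contraTN iv => /vZ vi; rewrite /scoord vi mulr0 ltxx.
have [|//|x [w' [xk xw' aw' xi']]] := IH w.
  have := proper_card sub; have := max_card (mem (Z w)); rewrite card_ord.
  move: Zd; move: #|Z u| => p; move: #|Z w| => q; clear; lia.
exists x, w'; split=> //; have -> : w' - u = (w' - w) + (w - u) by rewrite addrA subrK.
by rewrite xiD addr_ge0 // /w addrC addKr xiZ mulr_ge0.
Qed.

Lemma flat_unique x u w : #|x| = k -> flat V x u -> flat V x w -> u = w.
Proof.
move=> xk xu [Ew wx]; have [Eu ux] := xu; apply/eqP; rewrite -subr_eq0; apply/eqP.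
apply: (vertex_inj xk xu); first exact: eta_sub.
by move=> i ix; rewrite !mxE ux // wx // subr0.
Qed.

(** By ascend_to_vertex the maximum over the chamber is the maximum over its finitely
    many vertices. *)
Lemma maximum_at_vertex a : a \in bounded_feasible V ->
  exists2 x, x \in bases V & attains_max V a x.
Proof.
rewrite inE => /andP[/feasibleP[u0 Eu0 u0a] aB].
(* The vertices of the chamber, indexed by their sets of vanishing coordinates. *)
pose P x := (#|x| == k) && `[< exists u, flat V x u /\ Delta V a u >].
have /choice[pt ptP] : forall x, exists u, P x -> flat V x u /\ Delta V a u.
  move=> x; case: (boolP (P x)) => [/andP[_ /asboolP[u ux]]|]; first by exists u.
  by exists 0.
have [x0 [w0 [x0k fx0 dx0 _]]] := ascend_to_vertex aB (conj Eu0 u0a : Delta V a u0).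
have Px0 : P x0 by rewrite /P x0k eqxx; apply/asboolP; exists w0.
have [x Px xmax] := @arg_maxP _ _ _ x0 P (fun x => xi (pt x - u0)) Px0.
have [xk [fx dx]] : #|x| = k /\ flat V x (pt x) /\ Delta V a (pt x).
  by split; [case/andP: Px => /eqP | apply: ptP].
exists x; first by apply/basesP; split=> //; exists (pt x).
exists (pt x); split=> // w dw; rewrite -/(xi _).
have [x' [w' [x'k fx' dx' le]]] := ascend_to_vertex aB dw.
have Px' : P x' by rewrite /P x'k eqxx; apply/asboolP; exists w'.
have e : pt x' = w' by apply: (@flat_unique x') => //; case: (ptP x' Px').
have le' : xi (w' - u0) <= xi (pt x - u0) by rewrite -e; apply: xmax.
have xi_diff p q : xi (p - q) = xi (p - u0) - xi (q - u0).
  by rewrite -xiN -xiD opprB addrA subrK.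
by move: le; rewrite (xi_diff w) (xi_diff w'); lra.
Qed.

(** Near the vertex where a attains its maximum, the chamber of a is the cone defined by
    the coordinates in x. *)
Lemma maximum_cone a x v : #|x| = k -> attains_max V a x -> v \in Vs ->
  (forall i, i \in x -> 0 <= scoord a i v) -> xi v <= 0.
Proof.
move=> xk [u [fx [Eu ua] umax]] vV vx.
have [e e0 small] := small_step (fun i => scoord a i u) (fun i => scoord a i v).
have : Delta V a (u + e *: v).
  split=> [|i]; first by apply: eta_add => //; rewrite rpredZ.
  have ui : 0 <= scoord a i u := ua i.
  rewrite -/(scoord a i _) scoordD scoordZ; have [ix|ix] := boolP (i \in x).
    by rewrite addr_ge0 // mulr_ge0 ?vx // ltW.
  have ui0 : 0 < scoord a i u.
    by rewrite lt_neqAle ui andbT eq_sym scoord_eq0 (vertex_neq0 xk fx).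
  have := small i ui0; have := ler_norm (- scoord a i v); rewrite normrN; nra.
by move/umax; rewrite -/(xi _) addrC addKr xiZ pmulr_rle0.
Qed.

(** The signs of a outside x are those of the vertex, and by maximum_cone its signs on x
    are opposite to the coefficients of xi, which do not vanish. *)
Lemma maximum_unique a b x : #|x| = k -> attains_max V a x -> attains_max V b x -> a = b.
Proof.
move=> xk am bm; have [u [fx [Eu ua] _]] := am; have [u' [fx' [_ ub] _]] := bm.
have e := flat_unique xk fx fx'; rewrite -{}e in fx' ub.
have [d dV [dd dE]] := vertex_dual xk fx.
have dn := vertex_dual_neq0 xk dE.
apply/ffunP=> i; apply/eqP; apply: contraT => ab; have [ix|ix] := boolP (i \in x).
  have side c : attains_max V c x -> (-1) ^+ c i * xi (d i) <= 0.
    move=> cm; rewrite -xiZ; apply: (maximum_cone xk cm); first by rewrite rpredZ.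
    move=> j jx; rewrite /scoord mxE dd //.
    case: eqP => [->|]; rewrite ?mulr0 // mulr1 -expr2 sqrr_sign //.
  have := dn i ix; have := side a am; have := side b bm; move: ab.
  case: (a i); case: (b i) => //= _; rewrite ?expr1 ?expr0 ?mulN1r ?mul1r => h1 h2;
  by rewrite eq_le; lra.
have un := vertex_neq0 xk fx ix.
have h1 : 0 <= scoord a i u := ua i; have h2 : 0 <= scoord b i u := ub i.
move: un; rewrite -(scoord_eq0 a) eq_le; move: h2; rewrite (scoord_neq u ab) => h2.
by rewrite h1 andbT; lra.
Qed.

(** Take the chamber at the vertex whose signs on x are opposite to the coefficients of xi
    in the coordinates indexed by x. *)
Lemma vertex_attained x : x \in bases V ->
  exists2 a, a \in bounded_feasible V & attains_max V a x.
Proof.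
case/basesP=> xk [u fx]; have [Eu ux] := fx; have [d dV [dd dE]] := vertex_dual xk fx.
pose a : sign_vector n := [ffun i => if i \in x then 0 < xi (d i) else u 0 i < 0].
have ua i : 0 <= scoord a i u.
  rewrite /scoord ffunE; case: ifP => ix; first by rewrite ux ?mulr0.
  by rewrite -normrEsign.
have down v : v \in Vs -> (forall i, i \in x -> 0 <= scoord a i v) -> xi v <= 0.
  move=> vV vx; rewrite dE //; apply: sumr_le0 => i ix.
  have := vx i ix; rewrite /scoord ffunE ix; case: ltP => h; rewrite ?expr1 ?expr0; nra.
exists a.
  rewrite inE; apply/andP; split; first by apply/feasibleP; exists u.
  apply: contraT => /not_boundedP[v vV [v0 va]].
  by have := down v vV (fun i _ => va i); rewrite leNgt v0.
exists u; split=> // w [Ew wa]; rewrite -/(xi _); apply: down; first exact: eta_sub.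
by move=> i ix; have := wa i; rewrite /scoord !mxE ux // subr0.
Qed.

Lemma mu_spec x : x \in bases V -> mu V x \in bounded_feasible V /\ attains_max V (mu V x) x.
Proof.
move=> xB; rewrite /mu; case: pickP => [a /andP[aP /asboolP am]|no] //=.
by have [a aP am] := vertex_attained xB; have := no a; rewrite aP /= => /asboolP.
Qed.

(** The maximum over the chamber of a is attained at some vertex, and mu maps this vertex
    back to a by maximum_unique. *)
Lemma mu_inv_spec a : a \in bounded_feasible V ->
  [/\ #|mu_inv V a| = k, mu V (mu_inv V a) = a & attains_max V a (mu_inv V a)].
Proof.
move=> aP; rewrite /mu_inv; case: pickP => [x /andP[xB /eqP e]|no] /=.
  have [xk _] := basesP _ xB; split=> //.
  by have [_] := mu_spec xB; rewrite e.
have [x xB am] := maximum_at_vertex aP; have [xk _] := basesP _ xB.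
have := no x; rewrite xB /= => /eqP; case.
by have [_ am'] := mu_spec xB; apply: maximum_unique am' am.
Qed.

Lemma cone_feasible a b : a \in bounded_feasible V ->
  (forall i, i \notin mu_inv V a -> b i = a i) -> b \in feasible V.
Proof.
move=> /mu_inv_spec[xk _ [u [fx [Eu ua] _]]] ba; have [_ ux] := fx.
apply: (feasible_near Eu) => i ui; rewrite (@scoord_eq _ _ a); first exact: ua.
by rewrite ba //; apply: contra ui => ix; rewrite ux.
Qed.

End Vertices.

(** * Acyclicity of nerves of half-space covers *)

Section Nerve.
Local Open Scope ring_scope.
Variables (R : realType) (n k : nat) (V : polarized_arrangement R n k).
Variables (b : sign_vector n) (y D : {set 'I_n}).
Implicit Types (S T : {set 'I_n}) (v w : 'rV[R]_n).

Local Notation Vs := (pa_space V).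
Local Notation xi := (xi V).

(** For T empty these S form the nerve of the cover, by the half-spaces b_i v_i >= 0, of
    the convex set of the v with xi v > 0 and the signs of b on D.  The set T cuts this
    convex set along hyperplanes. *)
Definition escapes T S : bool := `[< exists2 v, v \in Vs & [/\ 0 < xi v,
  forall i, i \in D :|: S -> 0 <= scoord b i v & forall i, i \in T -> scoord b i v <= 0] >].

Hypothesis covered : forall v, v \in Vs -> (forall i, i \in D -> 0 <= scoord b i v) ->
  (forall i, i \in y -> scoord b i v <= 0) -> xi v <= 0.

Definition confined T S : bool := (S \subset y) && ~~ escapes T S.

Lemma confined_up T S l : l \in y -> confined T S -> confined T (l |: S).
Proof.
move=> ly /andP[Sy nS]; rewrite /confined subUset sub1set ly Sy /=.
apply: contra nS => /asboolP[v vV [v0 vS vT]]; apply/asboolP; exists v => //; split=> // i.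
by rewrite inE => iDS; apply: vS; rewrite !inE; case/orP: iDS => ->; rewrite ?orbT.
Qed.

Lemma escapes_face T S l : escapes T (l |: S) -> escapes T S.
Proof.
move=> /asboolP[v vV [v0 vS vT]]; apply/asboolP; exists v => //; split=> // i.
by rewrite inE => iDS; apply: vS; rewrite !inE; case/orP: iDS => ->; rewrite ?orbT.
Qed.

Lemma escapes_cut i T S : escapes (i |: T) S -> escapes T S.
Proof.
move=> /asboolP[v vV [v0 vS vT]]; apply/asboolP; exists v => //; split=> // l lT.
by apply: vT; rewrite inE lT orbT.
Qed.

Lemma escapes_side i T S : escapes T S -> ~~ escapes (i |: T) S -> escapes T (i |: S).
Proof.
move=> /asboolP[v vV [v0 vS vT]] nS; apply/asboolP; exists v => //; split=> // l.
rewrite setUCA in_setU1 => /orP[/eqP->|]; last exact: vS.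
rewrite leNgt; apply: contra nS => vi; apply/asboolP; exists v => //; split=> // m.
by rewrite in_setU1 => /orP[/eqP->|]; [apply: ltW|apply: vT].
Qed.

(** On the segment between a vector on each side of the hyperplane v_i = 0 there is a
    point of that hyperplane, by convexity. *)
Lemma escapes_cross i T S : escapes (i |: T) S -> escapes T (i |: S) ->
  escapes (i |: T) (i |: S).
Proof.
move=> /asboolP[w wV [w0 wS wT]] /asboolP[v vV [v0 vS vT]].
have wi : scoord b i w <= 0 by apply: wT; rewrite setU11.
have vi : 0 <= scoord b i v by apply: vS; rewrite !inE eqxx orbT.
apply/asboolP; have [wi0|wi0] := eqVneq (scoord b i w) 0.
  exists w => //; split=> // l; rewrite setUCA in_setU1 => /orP[/eqP->|]; last exact: wS.
  by rewrite wi0.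
have {}wi : scoord b i w < 0 by rewrite lt_neqAle wi0.
exists (scoord b i v *: w + (- scoord b i w) *: v); first by rewrite rpredD ?rpredZ.
have i0 : scoord b i (scoord b i v *: w + (- scoord b i w) *: v) = 0 by rewrite scoordD !scoordZ;
  ring.
split=> [|l|l]; first by rewrite xiD !xiZ; nra.
  rewrite setUCA in_setU1 => /orP[/eqP->|lS]; first by rewrite i0.
  have := wS l lS; have : 0 <= scoord b l v.
    by apply: vS; move: lS; rewrite !inE => /orP[]->; rewrite ?orbT.
  by rewrite scoordD !scoordZ; nra.
rewrite in_setU1 => /orP[/eqP->|lT]; first by rewrite i0.
have := vT l lT; have : scoord b l w <= 0 by apply: wT; rewrite inE lT orbT.
by rewrite scoordD !scoordZ; nra.
Qed.

(** Cut by the hyperplanes v_i = 0 for i in y.  The faces lost when i joins T come from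
    vectors on the positive side of the hyperplane, and they can all be extended by i, so
    they form a family that is invariant under toggling i.  When T is all of y there is
    no vector left, because the half-spaces cover, and the whole cube is acyclic. *)
Lemma confined_acyclic_in T : y != set0 -> T \subset y -> acyclic y (confined T).
Proof.
move=> y0; have [d] := ubnP #|y :\: T|; elim: d T => // d IH T Td Ty.
have [e|[i iyT]] := set_0Vmem (y :\: T).
  have {}e : T = y by apply/eqP; rewrite eqEsubset Ty -setD_eq0 e eqxx.
  have none S : ~~ escapes T S.
    apply/negP=> /asboolP[v vV [v0 vS vT]]; move: v0; rewrite ltNge.
    apply/negP; rewrite negbK; apply: covered => // i iD;
      [by apply: vS; rewrite inE iD|by apply: vT; rewrite e].
  have /set0Pn[i iy] := y0.
  apply: (acyclic_toggle iy) => S _.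
  by rewrite /confined !none subUset sub1set iy.
move: iyT; rewrite inE => /andP[iT iy].
have Ty' : i |: T \subset y by rewrite subUset sub1set iy.
apply: (@acyclic_sub _ _ _ (confined (i |: T))); last apply: IH => //.
- by move=> S l; apply: confined_up.
- by move=> S l; apply: confined_up.
- by move=> S /andP[Sy nS]; rewrite /confined Sy /=; apply: contra nS; apply: escapes_cut.
- apply: (acyclic_toggle iy) => S iS.
  rewrite /confined subUset sub1set iy /=; case: (S \subset y) => //=.
  rewrite !negbK; apply/andP/andP=> -[h1 h2].
    by split; [apply: contra h1 => h; apply: escapes_cross | apply: escapes_face h2].
  by split; [apply: contra h1; apply: escapes_face | apply: escapes_side].
apply: leq_trans (_ : #|y :\: T| <= d)%N => //; apply: proper_card; apply/properP; split.
  by rewrite setDS // subsetUr.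
by exists i; rewrite !inE ?iT ?eqxx.
Qed.

End Nerve.

(** A family of subsets of y has the same boundary maps in both cubes. *)
Lemma acyclic_restrict n (x y : {set 'I_n}) (F : pred {set 'I_n}) : y \subset x ->
  (forall S, F S -> S \subset y) -> acyclic y F -> acyclic x F.
Proof.
move=> yx Fy acc A.
have dE W S : supported F W -> F S -> int_boundary x W S = int_boundary y W S.
  move=> sW FS; rewrite /int_boundary (bigID (fun l => l \in y)) /= [X in (_ + X)%R]big1 ?addr0.
    apply: eq_bigl => l; rewrite !inE; case: (boolP (l \in y)) => ly; rewrite ?andbF //.
    by rewrite (subsetP yx) // !andbT.
  move=> l /andP[_ ly]; rewrite sW ?mulr0 //; apply: contra ly => /Fy/subsetP.
  by apply; rewrite setU11.
move=> [sA dA]; have [|W sW dW] := acc A; last by exists W => // S FS; rewrite dE ?dW.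
by split=> // S FS; rewrite -dE ?dA.
Qed.

(** * Coefficients of paths along minimal paths *)

Section Weights.
Variable n : nat.
Implicit Types (x y z w b c d : sign_vector n) (s r : seq (sign_vector n)) (i : 'I_n).

(** The coordinates crossed twice when going from x to z by way of y: the product of the
    minimal paths from x to y and from y to z is this monomial times the minimal path
    from x to z. *)
Definition detour x y z : 'X_{1..n} := [multinom ((x i == z i) && (y i != x i) : nat) | i < n].

Lemma detourE x y z i : detour x y z i = (x i == z i) && (y i != x i) :> nat.
Proof. by rewrite mnmE. Qed.

(** In each coordinate, detour x y z is half of d(x,y) + d(y,z) - d(x,z) for the Hamming
    distance d, which is a coboundary. *)
Lemma detour_cocycle x y z w : (detour x y w + detour y z w = detour x y z + detour x z w)%MM.
Proof.
apply/mnmP=> i; rewrite !mnmDE !detourE.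
by case: (x i); case: (y i); case: (z i); case: (w i).
Qed.

Lemma detour_xx x z : detour x x z = 0%MM.
Proof. by apply/mnmP=> i; rewrite detourE eqxx andbF mnm0E. Qed.

Lemma detour_zz x z : detour x z z = 0%MM.
Proof. by apply/mnmP=> i; rewrite detourE mnm0E; case: (x i); case: (z i). Qed.

Lemma detour_flip x i z : detour x (flip x i) z = if x i == z i then U_(i)%MM else 0%MM.
Proof.
apply/mnmP=> j; rewrite detourE flipE; have [->|ji] := eqVneq j i.
  by case: (x i); case: (z i); rewrite ?mnm1E ?mnm0E ?eqxx.
by rewrite addbF eqxx andbF; case: ifP; rewrite ?mnm1E ?mnm0E // [i == j]eq_sym (negPf ji).
Qed.

Lemma detour_flip_eq0 x i z : (detour x (flip x i) z == 0%MM) = (i \in sep x z).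
Proof. by rewrite detour_flip inE; case: (x i == z i); rewrite ?mnm1_eq0 ?eqxx. Qed.

Lemma adjacentP x y : reflect (exists i, y = flip x i) (adjacent x y).
Proof.
apply: (iffP cards1P) => -[i e]; exists i.
  apply/ffunP=> j; rewrite flipE; move/setP: e => /(_ j); rewrite !inE => <-.
  by case: (x j); case: (y j).
by apply/setP=> j; rewrite !inE e flipE; case: (x j); case: (j == i).
Qed.

Lemma flipK x i : flip (flip x i) i = x.
Proof. by apply/ffunP=> j; rewrite !flipE -addbA addbb addbF. Qed.

Lemma flipC x i j : flip (flip x i) j = flip (flip x j) i.
Proof. by apply/ffunP=> l; rewrite !flipE -!addbA (addbC (l == i)). Qed.

Lemma sep_flip x i z : i \in sep x z -> sep (flip x i) z = sep x z :\ i.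
Proof.
rewrite inE => xz; apply/setP=> j; rewrite !inE flipE.
have [->|ji] := eqVneq j i; last by rewrite addbF.
by case: (x i) xz; case: (z i).
Qed.

(** The coordinates crossed in the direction away from c.  When c is the end of the path,
    a coordinate crossed r times is counted once for each return, that is r/2 times rounded
    down; the paths of weight 0 are the minimal ones. *)
Fixpoint weight c x s : 'X_{1..n} :=
  if s is y :: s' then (detour x y c + weight c y s')%MM else 0%MM.

Lemma weight_cat c x s r : weight c x (s ++ r) = (weight c x s + weight c (last x s) r)%MM.
Proof. by elim: s x => [|y s IH] x /=; rewrite ?add0m // IH addmA. Qed.

(** Moving the reference point c costs a detour, by the cocycle rule. *)
Lemma weight_change c d x s : last x s = d -> weight c x s = (weight d x s + detour x d c)%MM.
Proof.
elim: s x => [|y s IH] x /= e; first by rewrite -e detour_xx addm0.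
by rewrite (IH y e) addmA (addmC (detour x y c)) -addmA detour_cocycle addmA
  (addmC (weight d y s)).
Qed.

End Weights.

Section TwistedPaths.
Local Open Scope ring_scope.
Variables (S : comNzRingType) (T : finType) (W : {set T}) (e : rel T).
Variable t : T -> T -> T -> S.
Hypothesis t_cocycle : forall x y z w, t x y w * t y z w = t x y z * t x z w.
Hypothesis t_xx : forall x z, t x x z = 1.
Local Notation PA := (path_algebra S W e).
Local Notation isq := (is_qpath W e).
Local Notation pe := (path_elt S W e).
Implicit Types (h : qpath W e -> S) (f g : PA) (x y z b c d : T) (s r : seq T).

Definition lin_form h f : S :=
  \sum_(p <- finmap.enum_fset (monalg.msupp f)) monalg.mcoeff p f * h p.

Lemma lin_formEw h f D : finmap.fsubset (monalg.msupp f) D ->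
  lin_form h f = \sum_(p <- finmap.enum_fset D) monalg.mcoeff p f * h p.
Proof.
move=> le; apply: finmap.big_fset_incl => // p _ /monalg.mcoeff_outdom ->.
by rewrite mul0r.
Qed.

Lemma lin_formP h a f g : lin_form h (a *: f + g) = a * lin_form h f + lin_form h g.
Proof.
pose D := finmap.fsetU (monalg.msupp f) (monalg.msupp g).
have lf : finmap.fsubset (monalg.msupp f) D by apply: finmap.fsubsetUl.
have lg : finmap.fsubset (monalg.msupp g) D by apply: finmap.fsubsetUr.
have lfg : finmap.fsubset (monalg.msupp (a *: f + g : monalg.malg _ _)) D.
  apply: finmap.fsubset_trans (monalg.msuppD_le _ _) _; apply: finmap.fsetSU.
  exact: monalg.msuppZ_le.
rewrite (lin_formEw h lf) (lin_formEw h lg) (lin_formEw h lfg).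
rewrite mulr_sumr -big_split /=; apply: eq_bigr => p _.
by rewrite monalg.mcoeffD monalg.mcoeffZ mulrDl mulrA.
Qed.

Lemma lin_form_basis h p : lin_form h (path_basis S p) = h p.
Proof.
rewrite (@lin_formEw h _ (finmap.fset1 p)); last exact: monalg.msuppU_le.
by rewrite finmap.big_seq_fset1 monalg.mcoeffUU mul1r.
Qed.

(** The path x :: s as a multiple of the minimal path between its ends, when t is the cost
    of a detour. *)
Fixpoint twist c x s : S := if s is y :: s' then t x y c * twist c y s' else 1.

Lemma twist_cat c x s r : twist c x (s ++ r) = twist c x s * twist c (last x s) r.
Proof. by elim: s x => [|y s IH] x /=; rewrite ?mul1r // IH mulrA. Qed.

Lemma twist_change c d x s : last x s = d -> twist c x s = twist d x s * t x d c.
Proof.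
elim: s x => [|y s IH] x /= ed; first by rewrite -ed t_xx mulr1.
by rewrite (IH y ed) mulrCA t_cocycle mulrCA mulrA.
Qed.

Definition path_coef b c (p : qpath W e) : S :=
  if val p is x :: s then ((x == b) && (last x s == c))%:R * twist c x s else 0.

(** The coefficient of f along the minimal path from b to c. *)
Definition tcoef b c f : S := lin_form (path_coef b c) f.

Lemma tcoefP b c a f g : tcoef b c (a *: f + g) = a * tcoef b c f + tcoef b c g.
Proof. exact: lin_formP. Qed.

#[local] Opaque tcoef pa_mul.

Lemma tcoefD b c f g : tcoef b c (f + g) = tcoef b c f + tcoef b c g.
Proof. by have := tcoefP b c 1 f g; rewrite scale1r mul1r. Qed.

Lemma tcoef0 b c : tcoef b c 0 = 0.
Proof. by apply: (addrI (tcoef b c 0)); rewrite -tcoefD !addr0. Qed.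

Lemma tcoefZ b c a f : tcoef b c (a *: f) = a * tcoef b c f.
Proof. by have := tcoefP b c a f 0; rewrite tcoef0 !addr0. Qed.

Lemma tcoefB b c f g : tcoef b c (f - g) = tcoef b c f - tcoef b c g.
Proof. by rewrite addrC -scaleN1r tcoefP mulN1r addrC. Qed.

Lemma tcoef_path b c x s : isq (x :: s) ->
  tcoef b c (pe (x :: s)) = ((x == b) && (last x s == c))%:R * twist c x s.
Proof.
move=> xs; pose p : qpath W e := Sub (x :: s) xs.
by rewrite -[x :: s]/(val p) path_elt_val [LHS]lin_form_basis.
Qed.

Lemma isq_cat x s r : isq (x :: s ++ r) = isq (x :: s) && isq (last x s :: r).
Proof.
rewrite /= all_cat cat_path; case: (boolP (x \in W)) => //= xW.
case: (boolP (all _ s)) => //= sW; case: (path _ x s); rewrite ?andbF //=.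
suff -> : last x s \in W by [].
have : last x s \in x :: s := mem_last x s.
by rewrite in_cons => /orP[/eqP->|/(allP sW)].
Qed.

Lemma path_elt0 s : ~~ isq s -> pe s = 0.
Proof. by move=> ns; rewrite /path_elt insubN. Qed.

Lemma path_elt_cat x s r : isq (x :: s ++ r) ->
  pe (x :: s ++ r) = pe (x :: s) * pe (last x s :: r).
Proof.
rewrite isq_cat => /andP[xs sr].
by rewrite [RHS](path_eltM _ xs sr) /= eqxx.
Qed.

Lemma tcoef_mul_path b c x s y r : isq (x :: s) -> isq (y :: r) ->
  tcoef b c (pa_mul (pe (x :: s)) (pe (y :: r))) =
  \sum_d tcoef b d (pe (x :: s)) * tcoef d c (pe (y :: r)) * t b d c.
Proof.
move=> xs yr; rewrite (bigD1 (last x s)) //= big1 ?addr0; last first.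
  move=> d ds; rewrite tcoef_path // (negPf (_ : last x s != d)) 1?eq_sym //.
  by rewrite andbF !mul0r.
rewrite path_eltM //= !tcoef_path // eqxx andbT.
have [e0|ne] := eqVneq (last x s) y; last by rewrite tcoef0 !mul0r mulr0 mul0r.
subst y; rewrite tcoef_path; last by rewrite isq_cat xs.
rewrite last_cat; case: eqP => [->|_] /=; rewrite ?mul0r // !mul1r.
case: eqP => [ec|_]; rewrite ?mul0r ?mulr0 ?mul0r // !mul1r.
by rewrite twist_cat (twist_change _ (erefl (last b s))) mulrAC.
Qed.

Lemma tcoef_pa_mul b c f g : tcoef b c (pa_mul f g) = \sum_d tcoef b d f * tcoef d c g * t b d c.
Proof.
elim/(@path_algebra_ind S): f => [|f f' Hf Hf'|a p].
- rewrite pa_mul0r tcoef0; apply/esym/big1 => d _.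
  by rewrite tcoef0 (mul0r (tcoef d c g)) (mul0r (t b d c)).
- rewrite pa_mulDl tcoefD (congr2 +%R Hf Hf') -big_split /=; apply: eq_bigr => d _.
  by rewrite tcoefD (mulrDl (tcoef b d f)) (mulrDl (tcoef b d f * tcoef d c g)).
rewrite pa_mulZl tcoefZ; under eq_bigr do rewrite tcoefZ -!mulrA.
rewrite -mulr_sumr; congr (_ * _).
elim/(@path_algebra_ind S): g => [|g g' Hg Hg'|a' q].
- rewrite pa_mulr0 tcoef0; apply/esym/big1 => d _.
  by rewrite (tcoef0 d c) (mul0r (t b d c)) mulr0.
- rewrite pa_mulDr tcoefD (congr2 +%R Hg Hg') -big_split /=; apply: eq_bigr => d _.
  by rewrite tcoefD (mulrDl (tcoef d c g)) mulrDr.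
rewrite pa_mulZr tcoefZ.
under eq_bigr do rewrite tcoefZ -(mulrA a') mulrCA.
rewrite -mulr_sumr; congr (_ * _); rewrite -!path_elt_val.
case: p => -[//|x s] /= xs; case: q => -[//|y r] /= yr.
by rewrite tcoef_mul_path //; apply: eq_bigr => d _; rewrite mulrA.
Qed.

(** Matrix multiplication twisted by the cocycle t: a product of minimal paths through d
    is a detour. *)
Lemma tcoef_mul b c f g : tcoef b c (f * g) = \sum_d tcoef b d f * tcoef d c g * t b d c.
Proof. exact: tcoef_pa_mul. Qed.

End TwistedPaths.

(** * Homotopy of minimal paths *)

Section MinimalPaths.
Variables (R : realType) (n k : nat) (V : polarized_arrangement R n k).
Implicit Types (x y z b c d : sign_vector n) (s r : seq (sign_vector n)) (i : 'I_n).
Local Notation F := (feasible V).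
Local Notation isq := (is_qpath F (@adjacent n)).

Definition minimal_path b c s := [&& isq (b :: s), last b s == c & weight c b s == 0%MM].

Definition geodesic b c : seq (sign_vector n) := xget [::] [set s | minimal_path b c s]%classic.

Lemma isq_cons x y s : isq (x :: y :: s) = [&& x \in F, adjacent x y & isq (y :: s)].
Proof. by rewrite /=; case: (x \in F); case: (y \in F); rewrite //= ?andbF // andbCA. Qed.

Lemma adjacent_flip x i : adjacent x (flip x i).
Proof. by apply/adjacentP; exists i. Qed.

Lemma minimal_path_cons b c i s : b \in F -> flip b i \in F ->
  minimal_path b c (flip b i :: s) = (i \in sep b c) && minimal_path (flip b i) c s.
Proof.
move=> bF dF; rewrite /minimal_path isq_cons bF adjacent_flip /= mnmD_eq0 detour_flip_eq0.
by case: (i \in sep b c); rewrite ?andbF.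
Qed.

Lemma sep_flip_card b c i : i \in sep b c -> (#|sep (flip b i) c| < #|sep b c|)%N.
Proof. by move=> iA; rewrite sep_flip // [X in (_ < X)%N](cardsD1 i) iA. Qed.

(** Cross a separating wall at each step, by feasible_step. *)
Lemma minimal_path_exists b c : b \in F -> c \in F -> exists s, minimal_path b c s.
Proof.
have [N] := ubnP #|sep b c|; elim: N b => // N IH b le bF cF.
have [->|bc] := eqVneq b c; first by exists [::]; rewrite /minimal_path /= cF !eqxx.
have [i iA dF] := feasible_step bF cF bc.
have [|//|//|s zs] := IH (flip b i).
  exact: leq_trans (sep_flip_card iA) le.
by exists (flip b i :: s); rewrite minimal_path_cons // iA.
Qed.

Lemma geodesicP b c : b \in F -> c \in F -> minimal_path b c (geodesic b c).
Proof. by move=> bF cF; have [s zs] := minimal_path_exists bF cF;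
  exact: (xgetPex [::] (ex_intro (fun s => minimal_path b c s) s zs)). Qed.

Section Classes.
Local Open Scope ring_scope.
Variables (A : pzRingType) (path_class : seq (sign_vector n) -> A).
Variable monomial_act : 'X_{1..n} -> A.
Hypothesis path_class_cat : forall x s r, isq (x :: s ++ r) ->
  path_class (x :: s ++ r) = path_class (x :: s) * path_class (last x s :: r).
Hypothesis monomial_act0 : monomial_act 0%MM = 1.
Hypothesis monomial_actD : forall m1 m2, monomial_act (m1 + m2)%MM =
  monomial_act m1 * monomial_act m2.
Hypothesis monomial_act_central : forall m (y : A), monomial_act m * y = y * monomial_act m.
Hypothesis path_class_out : forall e, e \in F :\: bounded_above V -> path_class [:: e] = 0.
Hypothesis path_class_square : forall a b c d, {subset [:: a; b; c; d] <= F} ->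
  uniq [:: a; b; c; d] -> path.cycle (@adjacent n) [:: a; b; c; d] ->
  path_class [:: a; b] * path_class [:: b; c] = path_class [:: a; d] * path_class [:: d; c].
Hypothesis path_class_back : forall a b i, a \in F -> b \in F -> adjacent a b -> a i != b i ->
  path_class [:: a; b] * path_class [:: b; a] = monomial_act U_(i)%MM * path_class [:: a].

Lemma path_class_cons x y s : isq (x :: y :: s) -> path_class (x :: y :: s) =
  path_class [:: x; y] * path_class (y :: s).
Proof. by move=> xys; rewrite -(@path_class_cat x [:: y] s). Qed.

Lemma adjacentC x y : adjacent x y = adjacent y x.
Proof. by rewrite /adjacent; congr (_ == _); apply: eq_card => i; rewrite !inE eq_sym. Qed.

Lemma square_flip b i j : i != j -> b \in F -> flip b i \in F -> flip b j \in F ->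
  flip (flip b i) j \in F ->
  path_class [:: b; flip b i] * path_class [:: flip b i; flip (flip b i) j] =
  path_class [:: b; flip b j] * path_class [:: flip b j; flip (flip b i) j].
Proof.
move=> ij bF biF bjF bijF; apply: path_class_square.
- by move=> x; rewrite !in_cons in_nil orbF => /or4P[]/eqP->.
- have dif x y l : x l != y l -> (x == y) = false by move=> h; apply: contraNF h => /eqP->.
  have ji : (j == i) = false by rewrite eq_sym (negPf ij).
  rewrite /= !inE !negb_or (@dif b (flip b i) i) ?(@dif b (flip (flip b i) j) i)
    ?(@dif b (flip b j) j) ?(@dif (flip b i) (flip (flip b i) j) j)
    ?(@dif (flip b i) (flip b j) i) ?(@dif (flip (flip b i) j) (flip b j) i) //;
  rewrite !flipE ?eqxx ?(negPf ij) ?ji ?addbF ?addbT; by case: (b _).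
- rewrite /= !adjacent_flip /= (flipC b i j) adjacentC adjacent_flip.
  by rewrite adjacentC adjacent_flip.
Qed.

(** By induction on the distance, the class of a minimal path only depends on its first
    step, and two first steps that span a square with b give the same class.  Connectedness
    of the walls of b that separate it from c reduces the general case to this one. *)
Lemma minimal_path_unique b c s r : c \in F -> minimal_path b c s -> minimal_path b c r ->
  path_class (b :: s) = path_class (b :: r).
Proof.
have [N] := ubnP #|sep b c|; elim: N b s r => // N IH b s r le cF zs zr.
have bF : b \in F by case/and3P: zs => /andP[/andP[]].
have head q : minimal_path b c q -> q = [::] /\ b = c \/
    exists i q', [/\ q = flip b i :: q', flip b i \in F, i \in sep b c & minimal_path (flip b i)
      c q'].
  case: q => [|y q]; first by case/and3P=> _ /eqP e _; left.
  move=> zq; right; have /and3P[qq _ _] := zq; move: qq; rewrite isq_cons.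
  case/and3P=> _ /adjacentP[i yi] yF; subst y; exists i, q.
  have dF : flip b i \in F by case/andP: yF => /andP[].
  by move: zq; rewrite minimal_path_cons // => /andP[].
have sep0 i : b = c -> i \in sep b c -> False by move=> ->; rewrite inE eqxx.
have dec i : i \in sep b c -> (#|sep (flip b i) c| < N)%N.
  by move=> iA; exact: leq_trans (sep_flip_card iA) le.
case: (head s zs) => [[-> e]|[i [s' [-> diF iA zs']]]].
  by case: (head r zr) => [[-> _]|[i [r' [_ _ iA _]]]] //; case: (sep0 i e).
case: (head r zr) => [[_ e]|[j [r' [-> djF jA zr']]]]; first by case: (sep0 i e).
(* The class of the minimal paths that start by crossing the wall l. *)
pose cc l := path_class [:: b; flip b l] * path_class (flip b l :: geodesic (flip b l) c).
have step l q : l \in sep b c -> flip b l \in F -> minimal_path (flip b l) c q ->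
    path_class (b :: flip b l :: q) = cc l.
  move=> lA dF zq; have /and3P[qq _ _] := zq.
  rewrite path_class_cons ?isq_cons ?bF ?adjacent_flip //; congr (_ * _).
  by apply: IH => //; [apply: dec | apply: geodesicP].
rewrite (step i) // (step j) //.
apply: (@walls_connected _ _ _ V A cc b c) => // l m lA mA lm dlF dmF dlmF.
pose e := flip (flip b l) m.
have half p q : p != q -> p \in sep b c -> q \in sep b c -> flip b p \in F ->
    flip (flip b p) q = e -> cc p = path_class [:: b; flip b p] * path_class [:: flip b p; e]
      * path_class (e :: geodesic e c).
  move=> pq pA qA dpF epq; have ze := geodesicP (dlmF : e \in F) cF.
  have zq : minimal_path (flip b p) c (e :: geodesic e c).
    by rewrite -epq minimal_path_cons ?epq // sep_flip // !inE eq_sym pq; move: qA;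
      rewrite inE => ->.
  have /and3P[qq _ _] := zq.
  rewrite -mulrA /cc; congr (_ * _); rewrite -path_class_cons //.
  by apply: IH => //; [apply: dec | apply: geodesicP].
rewrite (half l m) // (half m l) 1?eq_sym //; last by rewrite -flipC.
by rewrite square_flip.
Qed.

(** Adding an arrow in front of a minimal path either gives a minimal path or goes back
    along the first arrow of one, which produces the variable of the wall. *)
Lemma path_class_geodesic b s : isq (b :: s) ->
  path_class (b :: s) = monomial_act (weight (last b s) b s) * path_class
    (b :: geodesic b (last b s)).
Proof.
elim: s b => [|d s IH] b bs.
  have bF : b \in F by case/andP: bs => /andP[].
  rewrite /= monomial_act0 mul1r; apply: (minimal_path_unique bF _ (geodesicP bF bF)).
  by rewrite /minimal_path /= bF !eqxx.
move: (bs); rewrite isq_cons => /and3P[bF /adjacentP[i di] ds].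
have cF : last d s \in F.
  by have /andP[/allP sF _] : isq (d :: s) by []; exact/sF/mem_last.
have dF : d \in F by case/andP: ds => /andP[].
have zd := geodesicP dF cF; have zb := geodesicP bF cF.
rewrite path_class_cons // (IH d ds) mulrA -monomial_act_central -mulrA /=; set c :=
  last d s in cF zd zb *.
have /and3P[zdq _ _] := zd; have /and3P[zbq _ _] := zb.
rewrite di detour_flip; case: eqP => [e|ne].
  rewrite addmC monomial_actD -!mulrA; congr (_ * _).
  have adb : d = flip b i by [].
  have bd : b = flip d i by rewrite di flipK.
  have -> : path_class (flip b i :: geodesic (flip b i) c) = path_class [:: d; b] * path_class
    (b :: geodesic b c).
    rewrite -path_class_cons; last by rewrite isq_cons dF bd adjacent_flip -bd.
    rewrite -di; apply: (minimal_path_unique cF zd).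
    rewrite [in X in minimal_path _ _ X]bd minimal_path_cons -?bd // zb andbT inE di flipE eqxx e.
    by case: (c i).
  rewrite mulrA -di (@path_class_back b d i) //; last by rewrite di flipE eqxx; case: (b i).
    by rewrite -mulrA -path_class_cat.
  by rewrite di adjacent_flip.
rewrite add0m; congr (_ * _); rewrite -di -path_class_cons; last by rewrite isq_cons bF di
  adjacent_flip -di.
apply: (minimal_path_unique cF _ zb); rewrite di minimal_path_cons -?di // zd andbT inE;
  exact/eqP.
Qed.

(** The left side is the product of two minimal paths, which factors through the
    idempotent of e. *)
Lemma class_through_unbounded b c e : b \in F -> c \in F -> e \in F :\: bounded_above V ->
  monomial_act (detour b e c) * path_class (b :: geodesic b c) = 0.
Proof.
move=> bF cF eU; have eF : e \in F by move: eU; rewrite inE => /andP[].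
have /and3P[bz /eqP bl /eqP bw] := geodesicP bF eF; have /and3P[ez /eqP el /eqP ew] :=
  geodesicP eF cF.
have q : isq (b :: geodesic b e ++ geodesic e c) by rewrite isq_cat bz bl.
have := path_class_geodesic q; rewrite last_cat bl el weight_cat bl ew addm0.
rewrite (weight_change _ bl) bw add0m => <-; rewrite path_class_cat // bl.
by rewrite -[e :: geodesic e c]/([:: e] ++ geodesic e c) (@path_class_cat e [::] (geodesic e c))
  //= path_class_out // mul0r mulr0.
Qed.

End Classes.
End MinimalPaths.

(** * Normal form coefficients on the algebra *)

Lemma mcoeff_mulX (n : nat) (p : mpoly.mpoly n int) (u m : 'X_{1..n}) :
  ((p * 'X_[u])@_m = if (u <= m)%MM then p@_(m - u)%MM else 0)%R.
Proof.
case: ifP => [um|num]; first by rewrite -{1}(submK um) addmC mcoeffMX.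
apply/eqP; rewrite mcoeff_eq0 (perm_mem (msuppMX p u)); apply/negP=> /mapP[m' _ e].
by rewrite e lem_addr in num.
Qed.

Section NormalForm.
Local Open Scope ring_scope.
Variables (R : realType) (n k : nat) (V : polarized_arrangement R n k).
Implicit Types (x y z b c d e : sign_vector n) (s r : seq (sign_vector n)) (i : 'I_n)
  (m u : 'X_{1..n}).
Local Notation F := (feasible V).
Local Notation isq := (is_qpath F (@adjacent n)).
Local Notation Zt := (mpoly.mpoly n int).
Local Notation PA := (path_alg V).
Local Notation A := (Atilde V).
Local Notation pi := (rq_pi (@relator R n k V)).
Local Notation pe := (path_elt Zt F (@adjacent n)).
Implicit Types (f g h : PA) (a : Zt).

Definition detour_monomial x y z : Zt := 'X_[detour x y z].

Lemma detour_monomial_cocycle x y z w : detour_monomial x y w * detour_monomial y z w =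
  detour_monomial x y z * detour_monomial x z w.
Proof. by rewrite /detour_monomial -!mpolyXD detour_cocycle. Qed.

Lemma detour_monomial_xx x z : detour_monomial x x z = 1.
Proof. by rewrite /detour_monomial detour_xx mpolyX0. Qed.

Lemma twist_monomial c x s : twist detour_monomial c x s = 'X_[weight c x s].
Proof. by elim: s x => [|y s IH] x /=; rewrite ?mpolyX0 // IH mpolyXD. Qed.

Definition geo_coef b c (f : PA) : Zt := tcoef detour_monomial b c f.

#[local] Opaque pa_mul tcoef rq_mul.

Lemma geo_coefD b c f g : geo_coef b c (f + g) = geo_coef b c f + geo_coef b c g.
Proof. exact: tcoefD. Qed.

Lemma geo_coefB b c f g : geo_coef b c (f - g) = geo_coef b c f - geo_coef b c g.
Proof. exact: tcoefB. Qed.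

Lemma geo_coef0 b c : geo_coef b c 0 = 0.
Proof. exact: tcoef0. Qed.

Lemma geo_coefZ b c a f : geo_coef b c (a *: f) = a * geo_coef b c f.
Proof. exact: tcoefZ. Qed.

Lemma geo_coef_mul b c f g : geo_coef b c (f * g) = \sum_d geo_coef b d f * geo_coef d c g
  * 'X_[detour b d c].
Proof. exact: (tcoef_mul detour_monomial_cocycle detour_monomial_xx). Qed.

Lemma geo_coef_path b c x s : isq (x :: s) ->
  geo_coef b c (pe (x :: s)) = ((x == b) && (last x s == c))%:R * 'X_[weight c x s].
Proof. by move=> xs; rewrite -twist_monomial; apply: tcoef_path. Qed.

Lemma geo_coef_vertex b c x : geo_coef b c (vertex_idem V x) = [&& x \in F, x == b & x == c]%:R.
Proof.
have [xF|xF] := boolP (x \in F); last first.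
  by rewrite /vertex_idem path_elt0 ?geo_coef0 ?is_qpath1.
by rewrite geo_coef_path ?is_qpath1 // mpolyX0 mulr1.
Qed.

Lemma isq2 x y : isq [:: x; y] = [&& x \in F, y \in F & adjacent x y].
Proof. by rewrite /= !andbT andbA. Qed.

Lemma geo_coef_arrow b c x y : x \in F -> y \in F -> adjacent x y ->
  geo_coef b c (arrow V x y) = ((x == b) && (y == c))%:R.
Proof.
move=> xF yF xy; rewrite geo_coef_path ?isq2 ?xF ?yF //=; case: (y =P c) => [->|_].
  by rewrite detour_zz addm0 mpolyX0 mulr1.
by rewrite andbF mul0r.
Qed.

Lemma geo_coef_mul_vertex b c f x : x \in F ->
  geo_coef b c (f * vertex_idem V x) = (x == c)%:R * geo_coef b x f.
Proof.
move=> xF; rewrite geo_coef_mul (bigD1 x) //= big1 ?addr0.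
  rewrite geo_coef_vertex xF eqxx /=; case: (x =P c) => [->|_].
    by rewrite mulr1 mul1r detour_zz mpolyX0 mulr1.
  by rewrite !mul0r mulr0 mul0r.
by move=> d /negPf dx; rewrite geo_coef_vertex (eq_sym x d) dx andbF /= mulr0 mul0r.
Qed.

Lemma geo_coef_mul_arrow b c f x y : x \in F -> y \in F -> adjacent x y ->
  geo_coef b c (f * arrow V x y) = (y == c)%:R * (geo_coef b x f * 'X_[detour b x y]).
Proof.
move=> xF yF xy; rewrite geo_coef_mul (bigD1 x) //= big1 ?addr0.
  rewrite geo_coef_arrow // eqxx /=; case: (y =P c) => [->|_].
    by rewrite mulr1 mul1r.
  by rewrite !mul0r mulr0 mul0r.
by move=> d /negPf dx; rewrite geo_coef_arrow // (eq_sym x d) dx /= mulr0 mul0r.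
Qed.

Lemma geo_coef_arrow_arrow b c x y z : x \in F -> y \in F -> z \in F ->
  adjacent x y -> adjacent y z ->
  geo_coef b c (arrow V x y * arrow V y z) = ((x == b) && (z == c))%:R * 'X_[detour x y z].
Proof.
move=> xF yF zF xy yz; rewrite geo_coef_mul_arrow // geo_coef_arrow // eqxx andbT.
by case: (x =P b) => [->|_]; case: (z =P c); rewrite ?mul0r ?mulr0 ?mul1r ?mulr0.
Qed.

(** Two successive steps with different ends cross two different walls. *)
Lemma detour_two_steps x y z : adjacent x y -> adjacent y z -> x != z -> detour x y z = 0%MM.
Proof.
move=> /adjacentP[i ->] /adjacentP[j ->]; have [->|ij xz] := eqVneq i j.
  by rewrite flipK eqxx.
by rewrite detour_flip !flipE eqxx (negPf ij) addbF addbT; case: (x i).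
Qed.

(** The monomials t^m such that t^m p_bc is not zero in the algebra. *)
Definition alive b c m := [forall e in F :\: bounded_above V, ~~ (detour b e c <= m)%MM].

(** The coefficients of a square and of a back-and-forth relator cancel exactly; a product
    through an unbounded chamber e is divisible by the monomial of the detour through e. *)
Lemma geo_coef_relator b c f g h m : relator h -> alive b c m -> (geo_coef b c (f * h * g))@_m =
  0.
Proof.
move=> hr gm; have kill h' : (forall x y, geo_coef x y h' = 0) -> geo_coef b c (f * h' * g) = 0.
  move=> h0; rewrite geo_coef_mul big1 // => d _; rewrite geo_coef_mul big1 ?mul0r //.
  by move=> d' _; rewrite h0 mulr0 mul0r.
case: hr => [x xU|x y z w sF xyzw cyc|x y i xF yF xy xyi].
- have xF : x \in F by move: xU; rewrite inE => /andP[].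
  rewrite geo_coef_mul (bigD1 x) //= big1 ?addr0; last first.
    by move=> d /negPf dx; rewrite geo_coef_mul_vertex // eq_sym dx !mul0r.
  rewrite geo_coef_mul_vertex // eqxx mul1r mcoeff_mulX.
  by move/forall_inP: gm => /(_ x xU)/negPf ->.
- rewrite kill ?mcoeff0 // => b' c'; rewrite geo_coefB.
  have [xF yF zF wF] : [/\ x \in F, y \in F, z \in F & w \in F].
    by split; apply: sF; rewrite !in_cons eqxx ?orbT.
  move: cyc; rewrite /= andbT => /and4P[xy yz zw wx].
  have xw : adjacent x w by rewrite adjacentC. have wz : adjacent w z by rewrite adjacentC.
  have xz : x != z by apply: contraTneq xyzw => ->; rewrite /= !in_cons eqxx !orbT.
  have := geo_coef_arrow_arrow b' c' xF yF zF xy yz; rewrite detour_two_steps // => E1.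
  have := geo_coef_arrow_arrow b' c' xF wF zF xw wz; rewrite detour_two_steps // => E2.
  by apply/eqP; rewrite subr_eq0; apply/eqP; exact: etrans E1 (esym E2).
rewrite kill ?mcoeff0 // => b' c'; rewrite geo_coefB geo_coefZ.
have yx : adjacent y x by rewrite adjacentC.
rewrite geo_coef_arrow_arrow // geo_coef_vertex xF /=.
have [j yj] := adjacentP _ _ xy; have ij : i = j.
  by apply/eqP; apply: contraNT xyi => ij; rewrite yj flip_neq.
rewrite yj detour_flip eqxx -ij.
by case: (_ && _); rewrite ?mul1r ?mulr1 ?mul0r ?mulr0 subrr.
Qed.

Lemma geo_coef_ideal b c h m : in_ideal (@relator R n k V) h -> alive b c m ->
  (geo_coef b c h)@_m = 0.
Proof.
move=> hI gm; elim: hI => [|f h' g y hr _ IH]; first by rewrite geo_coef0 mcoeff0.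
rewrite geo_coefD mcoeffD.
exact: etrans (congr2 +%R (geo_coef_relator _ _ hr gm) IH) (addr0 0).
Qed.

Definition lift_path (y : A) : PA := sval (cid (rq_piP y)).

Lemma lift_pathK (y : A) : pi (lift_path y) = y.
Proof. exact: svalP (cid (rq_piP y)). Qed.

(** The coefficient of t^m p_bc.  It does not depend on the chosen representative of y
    because monomials that are not alive are discarded. *)
Definition normal_coef b c m (y : A) : int := if alive b c m then (geo_coef b c (lift_path y))@_m
  else 0.

Lemma normal_coef_degree b c m (y : A) : normal_coef b c m y != 0 ->
  (mdeg m < msize (geo_coef b c (lift_path y)))%N.
Proof.
rewrite /normal_coef; case: (alive b c m); last by rewrite eqxx.
by rewrite -mcoeff_msupp; apply: msize_mdeg_lt.
Qed.

Lemma normal_coef_pi b c m f : normal_coef b c m (pi f) = if alive b c m then (geo_coef b c f)@_m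
  else 0.
Proof.
have congr g : pi g = pi f -> alive b c m -> (geo_coef b c g)@_m = (geo_coef b c f)@_m.
  move=> /rq_pi_eq gf gm; have := geo_coef_ideal gf gm.
  by rewrite geo_coefB mcoeffB => /eqP; rewrite subr_eq0 => /eqP.
by rewrite /normal_coef; case: (boolP (alive b c m)) => [gm|_];
  [exact: congr (lift_pathK (pi f)) gm|].
Qed.

Lemma normal_coef_zmod b c m : zmod_morphism (normal_coef b c m).
Proof.
move=> y y'; have [f <-] := rq_piP y; have [g <-] := rq_piP y'.
have := normal_coef_pi b c m (f - g); rewrite geo_coefB mcoeffB (raddfB pi) => E.
apply: (etrans E).
apply: etrans (esym (congr2 (fun p q => p - q) (normal_coef_pi b c m f)
  (normal_coef_pi b c m g))).
by case: (alive b c m); [|rewrite subrr].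
Qed.
HB.instance Definition _ b c m := GRing.isZmodMorphism.Build A int (normal_coef b c m)
  (normal_coef_zmod b c m).

Lemma normal_coef_dead b c m (y : A) : ~~ alive b c m -> normal_coef b c m y = 0.
Proof. by rewrite /normal_coef => /negPf->. Qed.

(** A detour through e from b to x extends to one from b to y. *)
Lemma alive_shift b x y m : alive b y m -> (detour b x y <= m)%MM ->
  alive b x (m - detour b x y)%MM.
Proof.
move=> /forall_inP gm le; apply/forall_inP=> e eU; apply: contra (gm e eU) => /mnm_lepP le'.
apply/mnm_lepP=> i; have /mnmP/(_ i) := detour_cocycle b e x y.
have := le' i; have := mnm_lepP le i; rewrite !mnmDE mnmBE.
move: (detour b e x i) (detour b x y i) (detour b e y i) (detour e x y i) (m i) => *; lia.
Qed.

Lemma normal_coef_arrow b x y m (z : A) : x \in F -> y \in F -> adjacent x y ->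
  normal_coef b y m (z * pi (arrow V x y)) =
  if alive b y m && (detour b x y <= m)%MM then normal_coef b x (m - detour b x y)%MM z else 0.
Proof.
move=> xF yF xy; have [f <-] := rq_piP z.
have E := geo_coef_mul_arrow b y f xF yF xy; rewrite eqxx mul1r in E.
rewrite -(rmorphM pi); apply: etrans (normal_coef_pi b y m (f * arrow V x y)) _.
case: (boolP (alive b y m)) => [gm|_]; last by [].
rewrite E mcoeff_mulX andTb.
case: (boolP (detour b x y <= m)%MM) => [le|_]; last by [].
by apply: etrans (esym (normal_coef_pi b x _ f)); rewrite (alive_shift gm le).
Qed.

End NormalForm.

(** * Minimal paths span *)

Section Spanning.
Local Open Scope ring_scope.
Variables (R : realType) (n k : nat) (V : polarized_arrangement R n k).
Implicit Types (x y z b c d e : sign_vector n) (s r : seq (sign_vector n)) (i : 'I_n)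
  (m u : 'X_{1..n}).
Local Notation F := (feasible V).
Local Notation isq := (is_qpath F (@adjacent n)).
Local Notation Zt := (mpoly.mpoly n int).
Local Notation PA := (path_alg V).
Local Notation A := (Atilde V).
Local Notation pi := (rq_pi (@relator R n k V)).
Local Notation pe := (path_elt Zt F (@adjacent n)).
Local Notation geodesic := (geodesic V).
Implicit Types (f g h : PA) (a : Zt).

#[local] Opaque pa_mul tcoef rq_mul geo_coef normal_coef.

Fact class_key : unit. Proof. by []. Qed.

Definition scalar (a : Zt) : A := locked_with class_key (pi (a *: (1 : PA))).

Definition path_class s : A := locked_with class_key (pi (pe s)).

Lemma scalar_pi a : scalar a = pi (a *: (1 : PA)).
Proof. by rewrite /scalar locked_withE. Qed.

Lemma path_classE s : path_class s = pi (pe s).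
Proof. by rewrite /path_class locked_withE. Qed.

Lemma scalarE a f : scalar a * pi f = pi (a *: f).
Proof.
rewrite scalar_pi; apply: etrans (esym (rmorphM pi _ _)) _; congr (rq_pi _ _).
by apply: etrans (pa_mulZl a _ f) _; congr (_ *: _); apply: pa_mul1r.
Qed.

Lemma scalar_central a (y : A) : scalar a * y = y * scalar a.
Proof.
have [f <-] := rq_piP y; rewrite scalarE scalar_pi.
apply: etrans (rmorphM pi _ _); congr (rq_pi _ _).
by apply/esym; apply: etrans (pa_mulZr a f _) _; congr (_ *: _); apply: pa_mulr1.
Qed.

Lemma scalar1 : scalar 1 = 1.
Proof. by rewrite scalar_pi scale1r rmorph1. Qed.

Lemma scalarM a a' : scalar (a * a') = scalar a * scalar a'.
Proof.
have E := scalarE a (a' *: (1 : PA)); rewrite scalerA in E.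
apply: etrans (scalar_pi _) (etrans (esym E) _); congr (_ * _); exact: esym (scalar_pi a').
Qed.

Lemma scalarD a a' : scalar (a + a') = scalar a + scalar a'.
Proof. by rewrite !scalar_pi scalerDl raddfD. Qed.

Lemma scalar0 : scalar 0 = 0.
Proof. by rewrite scalar_pi scale0r raddf0. Qed.

Definition monomial_act m : A := scalar 'X_[m].

Lemma monomial_act0 : monomial_act 0%MM = 1.
Proof. by rewrite /monomial_act mpolyX0 scalar1. Qed.

Lemma monomial_actD m u : monomial_act (m + u)%MM = monomial_act m * monomial_act u.
Proof. by rewrite /monomial_act mpolyXD scalarM. Qed.

Lemma path_class_cat x s r : isq (x :: s ++ r) ->
  path_class (x :: s ++ r) = path_class (x :: s) * path_class (last x s :: r).
Proof.
move=> q; rewrite !path_classE; apply: etrans (rmorphM pi _ _); congr (rq_pi _ _).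
exact: path_elt_cat.
Qed.

Lemma path_class_relator f : relator f -> pi f = 0.
Proof.
move=> fr; rewrite -(raddf0 pi); apply/rq_pi_eq; rewrite subr0.
have := in_idealD 1 1 fr (in_ideal0 (@relator R n k V)).
by rewrite mul1r mulr1 addr0.
Qed.

Lemma path_class_out e : e \in F :\: bounded_above V -> path_class [:: e] = 0.
Proof. by move=> eU; rewrite path_classE; apply: path_class_relator; apply: relator_A1. Qed.

Lemma path_class_square (a b c d : sign_vector n) : {subset [:: a; b; c; d] <= F} ->
  uniq [:: a; b; c; d] -> path.cycle (@adjacent n) [:: a; b; c; d] ->
  path_class [:: a; b] * path_class [:: b; c] = path_class [:: a; d] * path_class [:: d; c].
Proof.
move=> sF un cyc; have := path_class_relator (relator_A2 sF un cyc).
rewrite raddfB => /eqP; rewrite subr_eq0 => /eqP E.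
by rewrite !path_classE; apply: etrans (etrans E _); [apply: esym|]; apply: (rmorphM pi).
Qed.

Lemma path_class_back (a b : sign_vector n) i : a \in F -> b \in F -> adjacent a b ->
  a i != b i ->
  path_class [:: a; b] * path_class [:: b; a] = monomial_act U_(i)%MM * path_class [:: a].
Proof.
move=> aF bF ab abi; have := path_class_relator (relator_A3 aF bF ab abi).
rewrite raddfB => /eqP; rewrite subr_eq0 => /eqP E.
by rewrite !path_classE; apply: etrans (etrans E _);
  [apply: esym; apply: (rmorphM pi)|rewrite [RHS]scalarE].
Qed.

Lemma path_class_normal b s : isq (b :: s) ->
  path_class (b :: s) = monomial_act (weight (last b s) b s) * path_class
    (b :: geodesic b (last b s)).
Proof.
by apply: (path_class_geodesic path_class_cat monomial_act0 monomial_actD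
  (fun m => scalar_central _) path_class_square path_class_back).
Qed.

Lemma path_class_unbounded b c e : b \in F -> c \in F -> e \in F :\: bounded_above V ->
  monomial_act (detour b e c) * path_class (b :: geodesic b c) = 0.
Proof.
apply: (class_through_unbounded path_class_cat monomial_act0 monomial_actD
  (fun m => scalar_central _)
  path_class_out path_class_square path_class_back).
Qed.

Definition geo_sum c (P : sign_vector n -> Zt) : A :=
  \sum_(b in F) scalar (P b) * path_class (b :: geodesic b c).

(** Each path that ends at c is a monomial times a minimal path. *)
Lemma span_vertex c f : c \in F ->
  pi f * pi (vertex_idem V c) = geo_sum c (fun b => geo_coef b c f).
Proof.
move=> cF; rewrite /geo_sum; elim/(@path_algebra_ind Zt): f => [|f g Hf Hg|a p].
- rewrite raddf0 (mul0r (pi (vertex_idem V c))); apply/esym/big1 => b _.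
  by rewrite geo_coef0 scalar0 mul0r.
- rewrite raddfD (mulrDl (pi f)); apply: etrans (congr2 +%R Hf Hg) _.
  rewrite -big_split /=; apply: eq_bigr => b _.
  by rewrite geo_coefD scalarD (mulrDl (scalar (geo_coef b c f))).
have -> : \sum_(b in F) scalar (geo_coef b c (a *: path_basis Zt p)) * path_class
  (b :: geodesic b c) =
    scalar a * \sum_(b in F) scalar (geo_coef b c (path_basis Zt p)) * path_class
      (b :: geodesic b c).
  by rewrite [RHS]mulr_sumr; apply: eq_bigr => b _; rewrite geo_coefZ scalarM;
    exact: esym (mulrA _ _ _).
rewrite -scalarE -(mulrA (scalar a)); congr (_ * _).
rewrite -path_elt_val; case: p => -[//|x s] xs; rewrite [val _]/=.
have xF : x \in F by case/andP: (xs) => /andP[].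
have sE b : scalar (geo_coef b c (pe (x :: s))) =
    if (x == b) && (last x s == c) then monomial_act (weight c x s) else 0.
  by rewrite geo_coef_path //; case: (_ && _); rewrite ?mul1r ?mul0r ?scalar0.
under eq_bigr do rewrite sE.
apply: etrans (esym (rmorphM pi _ _)) _.
apply: etrans (_ : pi (path_mul Zt F (@adjacent n) (x :: s) [:: c]) = _).
  by congr (rq_pi _ _); apply: path_eltM => //; rewrite is_qpath1.
rewrite /path_mul; case: (eqVneq (last x s) c) => [e|ne].
  rewrite cats0 (bigD1 x) //= eqxx big1 ?addr0.
    by apply: etrans (esym (path_classE _)) _; apply: etrans (path_class_normal xs) _; rewrite e.
  by move=> b /andP[_ bx]; rewrite (eq_sym x b) (negPf bx) mul0r.
by rewrite raddf0; apply/esym/big1 => b _; rewrite andbF mul0r.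
Qed.

Lemma geo_sum_zero c P : c \in F ->
  (forall b m, b \in F -> alive V b c m -> (P b)@_m = 0) -> geo_sum c P = 0.
Proof.
move=> cF P0; apply: big1 => b bF; rewrite (mpolyE (P b)).
rewrite (big_morph scalar scalarD scalar0) mulr_suml big1 // => m _.
have [gm|] := boolP (alive V b c m); first by rewrite P0 // scale0r scalar0 mul0r.
rewrite negb_forall_in => /existsP[e /andP[eU]]; rewrite negbK => le.
rewrite -(submK le) mpolyXD scalerAl scalarM -mulrA.
have Z : scalar 'X_[detour b e c] * path_class (b :: geodesic b c) =
  0 by exact: path_class_unbounded bF cF eU.
by move: (scalar _) => q; rewrite Z mulr0.
Qed.

(** The minimal paths that end at c span, by span_vertex, and all the monomials with a
    nonzero coefficient vanish in the algebra. *)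
Lemma normal_coef_faithful c (y : A) : c \in F -> y * pi (vertex_idem V c) = y ->
  (forall b m, normal_coef b c m y = 0) -> y = 0.
Proof.
move=> cF yc y0; rewrite -yc -(lift_pathK y) span_vertex //; apply: geo_sum_zero => // b m _ gm.
have := normal_coef_pi b c m (lift_path y); rewrite lift_pathK gm y0 => E; exact: esym E.
Qed.

Lemma normal_coef_outside b c m (y : A) : b \notin F -> normal_coef b c m y = 0.
Proof.
move=> bF; have [f <-] := rq_piP y; apply: etrans (normal_coef_pi b c m f) _.
case: (alive V b c m) => //; suff -> : geo_coef b c f = 0 by rewrite mcoeff0.
elim/(@path_algebra_ind Zt): f => [|f g Hf Hg|a p]; first exact: geo_coef0.
  by rewrite geo_coefD; apply: etrans (congr2 +%R Hf Hg) (addr0 0).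
rewrite geo_coefZ -path_elt_val; case: p => -[//|x s] xs; rewrite [val _]/= geo_coef_path //.
by case: (x =P b) bF xs => [<- /negPf|_ _ _]; rewrite /= ?mul0r ?mulr0 // => ->.
Qed.

Lemma geo_sum_lift c P : geo_sum c P = pi (\sum_(b in F) P b *: pe (b :: geodesic b c)).
Proof. by rewrite raddf_sum; apply: eq_bigr => b _; rewrite /= -scalarE -path_classE. Qed.

Lemma geo_sumK c P : c \in F -> geo_sum c P * pi (vertex_idem V c) = geo_sum c P.
Proof.
move=> cF; rewrite mulr_suml; apply: eq_bigr => b bF; rewrite -mulrA; congr (_ * _).
have /and3P[zq /eqP zl _] := geodesicP bF cF.
have := @path_class_cat b (geodesic b c) [::]; rewrite cats0 zl => /(_ zq) E.
exact: etrans (congr1 (fun q => path_class (b :: geodesic b c) * q) (esym (path_classE [:: c])))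
  (esym E).
Qed.

Lemma normal_coef_combination b c m P : b \in F -> c \in F ->
  normal_coef b c m (geo_sum c P) = if alive V b c m then (P b)@_m else 0.
Proof.
move=> bF cF; rewrite geo_sum_lift; apply: etrans (normal_coef_pi b c m _) _.
suff -> : geo_coef b c (\sum_(b' in F) P b' *: pe (b' :: geodesic b' c)) = P b by [].
rewrite (big_morph (geo_coef b c) (geo_coefD b c) (geo_coef0 V b c)) (bigD1 b) //= big1 ?addr0.
  have /and3P[zq /eqP zl /eqP zw] := geodesicP bF cF.
  by rewrite geo_coefZ geo_coef_path // zl zw !eqxx mul1r mpolyX0 mulr1.
move=> d /andP[dF /negPf db]; have /and3P[zq _ _] := geodesicP dF cF.
by rewrite geo_coefZ geo_coef_path // db mul0r mulr0.
Qed.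

End Spanning.

(** * Exactness of the cube complex *)

Lemma mcoeff_bounded (n B : nat) (c : 'X_{1..n} -> int) (m : 'X_{1..n}) :
  ((\sum_(u : 'X_{1..n < B}) c u *: 'X_[u] : mpoly.mpoly n int)@_m =
   if (mdeg m < B)%N then c m else 0)%R.
Proof.
case: ifP => [|le]; first exact: mcoeff_mpoly.
rewrite raddf_sum big1 // => u _; rewrite /= mcoeffZ mcoeffX.
case: eqP => [e|_]; last by rewrite mulr0.
by rewrite -e bmdeg in le.
Qed.

Section CubeComplex.
Local Open Scope ring_scope.
Variables (R : realType) (n k : nat) (V : polarized_arrangement R n k).
Variable a : sign_vector n.
Hypothesis aP : a \in bounded_feasible V.
Implicit Types (b c d e : sign_vector n) (i l : 'I_n) (m M : 'X_{1..n}) (S T : {set 'I_n}).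
Local Notation F := (feasible V).
Local Notation Zt := (mpoly.mpoly n int).
Local Notation A := (Atilde V).
Local Notation pi := (rq_pi (@relator R n k V)).
Local Notation x := (mu_inv V a).
Implicit Types (z w : {set 'I_n} -> A).

#[local] Opaque pa_mul tcoef rq_mul geo_coef normal_coef.

Definition flips S : sign_vector n := [ffun i => a i (+) (i \in S)].

Lemma flipsE S i : flips S i = a i (+) (i \in S).
Proof. by rewrite ffunE. Qed.

Lemma flips_add l S : l \notin S -> flips (l |: S) = flip (flips S) l.
Proof.
move=> lS; apply/ffunP=> i; rewrite flipE !flipsE in_setU1; have [->|_] := eqVneq i l.
  by rewrite (negPf lS) addbF.
by rewrite addbF.
Qed.

Lemma flips_adjacent l S : l \notin S -> adjacent (flips (l |: S)) (flips S).
Proof. by move=> lS; rewrite adjacentC flips_add // adjacent_flip. Qed.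

Lemma flips_feasible S : S \subset x -> flips S \in F.
Proof.
move=> /subsetP Sx; apply: (cone_feasible aP) => i ix.
by rewrite flipsE (negPf (contra (Sx i) ix)) addbF.
Qed.

Lemma setU1_subset l S : l \in x -> (l |: S \subset x) = (S \subset x).
Proof. by move=> lx; rewrite subUset sub1set lx. Qed.

Definition face_arrow T S : A := pi (arrow V (flips T) (flips S)).

Definition cube_boundary z S : A := \sum_(l in x :\: S) (z (l |: S) * face_arrow (l |: S) S) *~
  cube_sign l S.

(** An element of the term of degree p as a function of all sets of coordinates: its value on S
    lies in the summand of S, and it vanishes on the sets that do not index a summand. *)
Definition cube_chain (p : nat) z := forall S, z S * pi (vertex_idem V (flips S)) = z S /\
  (~~ ((S \subset x) && (#|S| == p)) -> z S = 0).

(** The differential multiplies t^m p_bc by t_l when l leaves a set and b agrees with a at l,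
    and only changes c otherwise.  Adding the variables of S where b agrees with a makes
    the multidegree constant. *)
Definition shift b S : 'X_{1..n} := [multinom ((i \in S) && (b i == a i) : nat) | i < n].

Lemma shiftE b S i : shift b S i = (i \in S) && (b i == a i) :> nat.
Proof. by rewrite mnmE. Qed.

Lemma shift_add b l S : l \notin S ->
  shift b (l |: S) = (shift b S + detour b (flips (l |: S)) (flips S))%MM.
Proof.
move=> lS; apply/mnmP=> i; rewrite mnmDE !shiftE detourE !flipsE in_setU1.
have [->|_] /= := eqVneq i l; first by rewrite (negPf lS); case: (b l); case: (a l).
by case: (i \in S); case: (b i); case: (a i).
Qed.

(** The part of z that starts at b and has multidegree M. *)
Definition slice b M z S : int :=
  if (shift b S <= M)%MM then normal_coef b (flips S) (M - shift b S)%MM (z S) else 0.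

Definition slice_supp b M S : bool :=
  [&& S \subset x, (shift b S <= M)%MM & alive V b (flips S) (M - shift b S)%MM].

Lemma shift_step b l S M : l \notin S -> (shift b S <= M)%MM ->
  (detour b (flips (l |: S)) (flips S) <= M - shift b S)%MM = (shift b (l |: S) <= M)%MM.
Proof.
move=> lS /mnm_lepP le; rewrite shift_add //; apply/mnm_lepP/mnm_lepP => h i;
have := h i; have := le i; rewrite !mnmDE !mnmBE; move: (shift b S i) (detour _ _ _ i) (M i) =>
  *; lia.
Qed.

(** In each multidegree the differential is that of the cube, restricted to the sets whose
    monomial is alive. *)
Lemma slice_boundary b M z S : S \subset x ->
  slice b M (cube_boundary z) S = if slice_supp b M S then int_boundary x (slice b M z) S else 0.
Proof.
move=> Sx; rewrite /slice_supp Sx {1}/slice /=; case: (boolP (shift b S <= M)%MM) => [le|_];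
  last by [].
rewrite /= /cube_boundary raddf_sum /=.
have E l : l \in x :\: S -> normal_coef b (flips S) (M - shift b S)%MM
  ((z (l |: S) * face_arrow (l |: S) S) *~ cube_sign l S)
    = if alive V b (flips S) (M - shift b S)%MM then cube_sign l S * slice b M z (l |: S) else 0.
  rewrite inE => /andP[lS lx]; rewrite raddfMz /= normal_coef_arrow.
  - rewrite shift_step // /slice shift_add // submDA mulrC; case: (alive _ _ _ _);
    last by rewrite mul0rz.
    by rewrite /= mulrzz; case: ifP; rewrite ?mul0r.
  - by rewrite flips_feasible // setU1_subset.
  - exact: flips_feasible.
  - exact: flips_adjacent.
rewrite (eq_bigr _ E); case: (alive _ _ _ _); first by [].
by rewrite big1.
Qed.

Lemma arrow_vertex c d : pi (arrow V c d) * pi (vertex_idem V d) = pi (arrow V c d).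
Proof.
apply: etrans (esym (rmorphM pi _ _)) _; congr (rq_pi _ _).
have [q|nq] := boolP (is_qpath F (@adjacent n) [:: c; d]); last first.
  by rewrite /arrow (path_elt0 _ nq); apply: pa_mul0r.
have dF : d \in F by move: q; rewrite isq2 => /and3P[].
by apply: etrans (path_eltM _ q _) _; rewrite ?is_qpath1 //= eqxx.
Qed.

Lemma cube_boundary_chain j z : cube_chain j.+1 z -> cube_chain j (cube_boundary z).
Proof.
move=> zc S; split.
  rewrite /cube_boundary mulr_suml; apply: eq_bigr => l _; rewrite mulrzAl -mulrA.
  by rewrite /face_arrow arrow_vertex.
move=> nS; rewrite /cube_boundary big1 // => l; rewrite inE => /andP[lS lx].
have [_ ->] := zc (l |: S); first by rewrite mul0r mul0rz.
by rewrite setU1_subset // cardsU1 lS add1n eqSS.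
Qed.

Lemma cube_chain_zero j z S : cube_chain j z -> S \subset x ->
  (forall b M, b \in F -> slice b M z S = 0) -> z S = 0.
Proof.
move=> zc Sx z0; have [zv _] := zc S.
apply: (normal_coef_faithful (flips_feasible Sx) zv) => b m.
have [bF|bF] := boolP (b \in F); last exact: normal_coef_outside.
by have := z0 b (m + shift b S)%MM bF; rewrite /slice lem_addl addmK.
Qed.

Lemma slice_supported b M j z : cube_chain j z -> supported (slice_supp b M) (slice b M z).
Proof.
move=> zc S; rewrite /slice /slice_supp.
case: (boolP (shift b S <= M)%MM) => // _; case: (boolP (S \subset x)) => [_|Sx _].
  exact: normal_coef_dead.
by have [_ ->] := zc S; rewrite ?raddf0 // (negPf Sx).
Qed.

Lemma shift_mono b M l S : (shift b (l |: S) <= M)%MM -> (shift b S <= M)%MM.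
Proof.
move=> /mnm_lepP le; apply/mnm_lepP=> i; apply: leq_trans (le i); rewrite !shiftE in_setU1.
by case: (i \in S); case: (b i == a i); rewrite ?orbT.
Qed.

Lemma slice_supp_up b M l S : l \in x -> l \notin S -> slice_supp b M S ->
  (shift b (l |: S) <= M)%MM ->
  slice_supp b M (l |: S).
Proof.
move=> lx lS /and3P[Sx le gM] le'; rewrite /slice_supp setU1_subset // Sx le' /=.
by rewrite shift_add // -submDA; apply: alive_shift; rewrite // shift_step.
Qed.

(** In each multidegree this is the vanishing of the square of the differential of the
    cube.  A set with an admissible shift that lies between two sets of slice_supp is in
    slice_supp too. *)
Lemma cube_boundary_boundary j z S : cube_chain j.+2 z -> cube_boundary (cube_boundary z) S = 0.
Proof.
move=> zc; have dzc := cube_boundary_chain zc; have ddzc := cube_boundary_chain dzc.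
have [Sx|Sx] := boolP (S \subset x); last by have [_ ->] := ddzc S; rewrite // (negPf Sx).
apply: (cube_chain_zero ddzc Sx) => b M bF; rewrite slice_boundary //; case: ifP => // FS.
rewrite -[RHS](int_boundary_boundary x (slice b M z) S); apply: eq_bigr => l;
  rewrite inE => /andP[lS lx].
congr (_ * _); rewrite slice_boundary ?setU1_subset //; case: ifP => // /negbT nF.
apply/esym/big1 => l' _; rewrite /slice; case: ifP => [/shift_mono le|_]; last by rewrite mulr0.
by rewrite slice_supp_up in nF.
Qed.

(** Either M involves a coordinate i in x, and membership is invariant under toggling i,
    or it is equivalent to being confined, for the half-spaces of the coordinates of x
    where b and a differ.  When there are no such coordinates only the empty set is left;
    it then contributes to V_a. *)
Lemma slice_supp_acyclic b M : b \in F ->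
  (forall S, slice_supp b M S -> S = set0) \/ acyclic x (slice_supp b M).
Proof.
move=> bF; have [xk _ amax] := mu_inv_spec aP.
have [/existsP[i /andP[ix Mi]]|none] := boolP [exists i in x, (0 < M i)%N].
  right; apply: (acyclic_toggle ix) => S iS; rewrite /slice_supp setU1_subset //; congr (_ && _).
  have shi : (shift b (i |: S) <= M)%MM = (shift b S <= M)%MM.
    apply/mnm_lepP/mnm_lepP => h j; have := h j; rewrite !shiftE in_setU1;
    have [->|_] //= := eqVneq j i.
      by rewrite (negPf iS).
    by move=> _; apply: leq_trans (leq_b1 _) Mi.
  rewrite shi; congr (_ && _); rewrite /alive; apply: eq_forallb_in => e _; congr (~~ _).
  apply/mnm_lepP/mnm_lepP => h j; have := h j; rewrite !detourE !mnmBE !shiftE !flipsE in_setU1;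
  have [->|_] //= := eqVneq j i; rewrite (negPf iS) /=; move: Mi;
  by case: (M i) => // p; case: (b i); case: (a i); case: (e i); rewrite ?subn1 ?subn0.
have M0 i : i \in x -> M i = 0%N.
  by move=> ix; apply/eqP; rewrite -leqn0 leqNgt; apply: contra none => Mi; apply/existsP;
    exists i; rewrite ix.
(* Here shift b S <= M means that S is contained in y, as M vanishes on x. *)
pose y := [set i in x | b i != a i]; pose D := [set i | (M i == 0%N) && (b i == a i)].
have yx : y \subset x by apply/subsetP=> i; rewrite inE => /andP[].
have shy S : (S \subset x) && (shift b S <= M)%MM = (S \subset y).
  apply/andP/subsetP => [[/subsetP Sx /mnm_lepP le] i iS|Sy].
    rewrite inE Sx //=; have := le i; rewrite shiftE iS M0 ?Sx //=.
    by case: (b i == a i).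
  split; first by apply/subsetP=> i /Sy; rewrite inE => /andP[].
  apply/mnm_lepP=> i; rewrite shiftE; case: (boolP (i \in S)) => //= /Sy.
  by rewrite inE => /andP[_ /negPf->].
have sh0 S : S \subset y -> shift b S = 0%MM.
  move=> /subsetP Sy; apply/mnmP=> i; rewrite shiftE mnm0E.
  by case: (boolP (i \in S)) => //= /Sy; rewrite inE => /andP[_ /negPf->].
have famE S : slice_supp b M S = confined V b y D set0 S.
  rewrite /slice_supp andbA shy /confined; case: (boolP (S \subset y)) => //= Sy.
  rewrite sh0 // subm0; have /subsetP Syi := Sy.
  have agree e : (detour b e (flips S) <= M)%MM <-> (forall i, i \in D :|: S -> e i = b i).
    have key i : (detour b e (flips S) i <= M i)%N = ((i \in D :|: S) ==> (e i == b i)).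
      rewrite detourE flipsE in_setU !inE; case: (boolP (i \in S)) => /= [iS|iS].
        have := Syi i iS; rewrite inE => /andP[ix ba]; rewrite M0 // orbT /=.
        by move: ba; case: (b i); case: (a i); case: (e i).
      rewrite orbF addbF; case: (M i) => [|p] /=; last by rewrite (leq_trans (leq_b1 _)).
      by case: (b i); case: (a i); case: (e i).
    split=> [/mnm_lepP h i iD|h].
      by have := h i; rewrite key iD /= => /eqP.
    by apply/mnm_lepP=> i; rewrite key; apply/implyP=> iD; rewrite h.
  have [U1 U2] := unbounded_agreeP (D :|: S) bF.
  rewrite /alive; apply/forall_inP/idP => [h|nE e eU].
    apply/asboolP=> -[v vV [v0 vS _]]; have [|e eU /agree le] := U2.
      by exists v.
    by have := h e eU; rewrite le.
  apply: contra nE => /agree le; apply/asboolP.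
  have [|v vV [v0 vS]] := U1; first by exists e.
  by exists v => //; split=> // i; rewrite inE.
have [y0|y0] := eqVneq y set0.
  left=> S; rewrite famE => /andP[]; rewrite y0 subset0 => /eqP//.
right; apply: (acyclic_restrict yx) => [S|]; first by rewrite famE => /andP[].
suff : acyclic y (confined V b y D set0).
  by move=> acc; rewrite (_ : slice_supp b M = confined V b y D set0) //; apply/funext.
apply: confined_acyclic_in => //; last exact: sub0set.
move=> v vV vD vy; apply: (maximum_cone xk amax vV) => i ix.
have [e|ne] := eqVneq (b i) (a i).
  by rewrite (scoord_eq v e); apply: vD; rewrite inE M0 // e !eqxx.
by rewrite (scoord_neq v ne) oppr_ge0; apply: vy; rewrite inE ix.
Qed.

Lemma slice_bounded z : exists B : nat, forall b M S, (B <= mdeg M)%N -> slice b M z S = 0.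
Proof.
pose sz b S := msize (geo_coef b (flips S) (lift_path (z S))).
exists ((\max_b \max_S sz b S) + n)%N => b M S le; rewrite /slice; case: ifP => // shM.
apply/eqP; apply: contraTT le => /normal_coef_degree lt; rewrite -ltnNge.
rewrite -(submK shM) mdegD -addSn; apply: leq_add.
  apply: leq_trans lt _; apply: leq_trans (leq_bigmax b).
  exact: (leq_bigmax (F := sz b) S).
rewrite mdegE -[X in (_ <= X)%N]card_ord -sum1_card; apply: leq_sum => i _.
by rewrite shiftE leq_b1.
Qed.

(** The third clause makes the sum of the lifts over all multidegrees finite. *)
Lemma slice_lift j z b M : cube_chain j.+1 z -> (forall S, cube_boundary z S = 0) -> b \in F ->
  exists W, [/\ supported (slice_supp b M) W, forall S, slice_supp b M S -> int_boundary x W S =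
    slice b M z S,
    (forall S, slice b M z S = 0) -> forall S, W S = 0 & forall S, #|S| != j.+2 -> W S = 0].
Proof.
move=> zc z0 bF.
have zS S : #|S| != j.+1 -> slice b M z S = 0.
  move=> nS; rewrite /slice; case: ifP => // _; have [_ ->] := zc S; first exact: raddf0.
  by rewrite (negPf nS) andbF.
have [all0|] := pselect (forall S, slice b M z S = 0).
  exists (fun _ => 0); split=> // S _; rewrite all0 /int_boundary big1 // => l _.
  by rewrite mulr0.
have sup := @slice_supported b M _ z zc.
move=> not0; have [only0|acc] := slice_supp_acyclic M bF.
  case: not0 => S; have [/only0->|/sup//] := boolP (slice_supp b M S).
  by apply: zS; rewrite cards0.
have [|W sW dW] := acc (slice b M z).
  split=> // S FS; have Sx : S \subset x by case/and3P: FS.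
  have := slice_boundary b M z Sx; rewrite FS => <-.
  by rewrite /slice z0 raddf0; case: ifP.
exists (fun S => if #|S| == j.+2 then W S else 0); split=> [S nF|S FS|//|S /negPf->//].
  by rewrite sW //; case: ifP.
have [Sj|Sj] := eqVneq #|S| j.+1.
  rewrite -dW //; apply: eq_bigr => l; rewrite inE => /andP[lS _].
  by rewrite cardsU1 lS Sj eqxx.
rewrite zS // /int_boundary big1 // => l; rewrite inE => /andP[lS _].
by rewrite cardsU1 lS add1n eqSS (negPf Sj) mulr0.
Qed.

(** Lift each slice and sum the monomials t^m p_bc with the resulting coefficients. *)
Lemma cube_boundary_exact j z : cube_chain j.+1 z -> (forall S, cube_boundary z S = 0) ->
  exists2 w, cube_chain j.+2 w & forall S, cube_boundary w S = z S.
Proof.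
move=> zc z0; have [B zB] := slice_bounded z.
have /choice[W WP] : forall bM : sign_vector n * 'X_{1..n}, exists W, bM.1 \in F ->
    [/\ supported (slice_supp bM.1 bM.2) W,
      forall S, slice_supp bM.1 bM.2 S -> int_boundary x W S = slice bM.1 bM.2 z S,
      (forall S, slice bM.1 bM.2 z S = 0) -> forall S, W S = 0 & forall S, #|S| != j.+2 ->
        W S = 0].
  case=> b M /=; have [bF|_] := boolP (b \in F); last by exists (fun _ => 0).
  by have [W WP] := slice_lift M zc z0 bF; exists W.
pose P S b : Zt := \sum_(u : 'X_{1..n < B}) W (b, (u + shift b S)%MM) S *: 'X_[u].
pose w S : A := if S \subset x then geo_sum V (flips S) (P S) else 0.
have wc : cube_chain j.+2 w.
  move=> S; rewrite /w; case: (boolP (S \subset x)) => Sx; last by rewrite mul0r.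
  split=> [|nS]; first exact: geo_sumK (flips_feasible Sx).
  apply: geo_sum_zero (flips_feasible Sx) _ => b m bF _.
  rewrite (mcoeff_bounded B (fun u => W (b, (u + shift b S)%MM) S)); case: ifP => // _.
  by have [_ _ _ ->] := WP (b, (m + shift b S)%MM) bF.
have cw b M S : b \in F -> S \subset x -> slice b M w S = W (b, M) S.
  move=> bF Sx; have [sW _ W0 _] := WP (b, M) bF.
  have [FS|nF] := boolP (slice_supp b M S); last first.
    by rewrite (@slice_supported b M _ w wc) // sW.
  have /and3P[_ le gM] := FS; rewrite /slice le /w Sx normal_coef_combination ?flips_feasible //.
  rewrite gM (mcoeff_bounded B (fun u => W (b, (u + shift b S)%MM) S)) submK //.
  case: ltnP => // ge.
  rewrite W0 // => T; apply: zB; apply: leq_trans ge _.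
  by rewrite -[X in (_ <= mdeg X)%N](submK le) mdegD leq_addr.
exists w => // S; apply/eqP; rewrite -subr_eq0; apply/eqP.
have dwc := cube_boundary_chain wc.
have dc : cube_chain j.+1 (fun S => cube_boundary w S - z S).
  move=> T; have [dv d0] := dwc T; have [zv zz] := zc T.
  by split=> [|nT]; [rewrite mulrBl dv zv|rewrite d0 ?zz ?subrr].
have [Sx|Sx] := boolP (S \subset x); last first.
  by have [_ ->] := dc S; rewrite // (negPf Sx).
apply: (cube_chain_zero dc Sx) => b M bF.
have -> : slice b M (fun S => cube_boundary w S - z S) S = slice b M (cube_boundary w) S - slice
  b M z S.
  by rewrite /slice; case: (shift b S <= M)%MM; [exact: raddfB|rewrite subrr].
rewrite slice_boundary //; have [FS|nF] := boolP (slice_supp b M S); last first.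
  by rewrite (@slice_supported b M _ z zc) ?subrr.
have [_ dW _ _] := WP (b, M) bF; rewrite -dW //; apply/eqP; rewrite subr_eq0; apply/eqP.
apply: eq_bigr => l; rewrite inE => /andP[_ lx].
by rewrite cw ?setU1_subset.
Qed.

End CubeComplex.

(** * Projective modules *)

Section Projectives.
Local Open Scope ring_scope.
Variable A : pzRingType.

Lemma in_principalP (u y : A) : u * u = u -> (y \in in_principal u) = (y * u == y).
Proof.
move=> uu; apply/asboolP/eqP => [[c ->]|<-]; first by rewrite -mulrA uu.
by exists y.
Qed.

(** A map out of A u is determined by the image of u, and any preimage p of that image
    lifts the map by y |-> y p, since y u = y on A u. *)
Lemma principal_projective (u : A) : u * u = u -> projective (principal u).
Proof.
move=> uu M N g f gs.
have ue : u \in in_principal u by rewrite in_principalP // uu.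
pose e : principal u := Sub (u : A^o) ue.
have [p gp] := gs (f e).
pose h (y : principal u) : M := (val y : A) *: p.
have hl : linear h by move=> c y z; rewrite /h scalerDl -scalerA.
pose H : {linear principal u -> M} := HB.pack h (GRing.isLinear.Build A (principal u) M *:%R h
  hl).
exists H => y; rewrite /= /h linearZ /= gp -linearZ /=; congr (f _); apply: val_inj => /=.
have : (val y : A) \in in_principal u by exact: (svalP y).
by rewrite in_principalP // => /eqP.
Qed.

Variables (J : finType) (M : J -> lmodType A).

Definition dsum_incl j (p : M j) : dsum M := [ffun i => dfwith (fun i => 0 : M i) p i].

Lemma dsum_incl_linear j : linear (@dsum_incl j).
Proof.
move=> c p q; apply/ffunP=> i; rewrite !ffunE.
have [e|ne] := eqVneq j i; first by subst i; rewrite !dfwith_in.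
by rewrite !dfwith_out // scaler0 addr0.
Qed.
HB.instance Definition _ j :=
  GRing.isLinear.Build A (M j) (dsum M) *:%R (@dsum_incl j) (@dsum_incl_linear j).

Lemma dsum_sumE (I : Type) (r : seq I) (F : I -> dsum M) j :
  (\sum_(i <- r) F i) j = \sum_(i <- r) F i j.
Proof. by elim: r => [|i r IH]; rewrite ?big_nil ?big_cons ffunE // IH. Qed.

Lemma dsum_decomposition (y : dsum M) : y = \sum_j dsum_incl (y j).
Proof.
apply/ffunP=> i; rewrite dsum_sumE (bigD1 i) //= ffunE dfwith_in big1 ?addr0 // => j ji.
by rewrite ffunE dfwith_out.
Qed.

Lemma dsum_projective : (forall j, projective (M j)) -> projective (dsum M).
Proof.
move=> Mp X N g f gs.
have partial j : exists h : {linear M j -> X}, forall p, g (h p) = f (dsum_incl p).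
  exact: (Mp j X N g (f \o @dsum_incl j)).
pose hj j := sval (cid (partial j)).
have hjP j p : g (hj j p) = f (dsum_incl p) := svalP (cid (partial j)) p.
pose h (y : dsum M) : X := \sum_j hj j (y j).
have hl : linear h.
  move=> c y z; rewrite /h scaler_sumr -big_split /=; apply: eq_bigr => j _.
  by rewrite !ffunE linearP.
pose H : {linear dsum M -> X} := HB.pack h (GRing.isLinear.Build A (dsum M) X *:%R h hl).
exists H => y; rewrite /= /h linear_sum [in RHS](dsum_decomposition y) linear_sum.
by apply: eq_bigr => j _; apply: hjP.
Qed.

End Projectives.

(** * Degrees *)

Section Grading.
Local Open Scope ring_scope.
Variables (R : realType) (n k : nat) (V : polarized_arrangement R n k).
Local Notation F := (feasible V).
Local Notation Zt := (mpoly.mpoly n int).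
Local Notation A := (Atilde V).
Local Notation PA := (path_algebra Zt F (@adjacent n)).
Local Notation pi := (rq_pi (@relator R n k V)).
Local Notation pe := (path_elt Zt F (@adjacent n)).
Local Notation hom := (@path_alg_homogeneous R n k V).

Lemma homogeneous_path_alg0 d : hom d 0.
Proof. by move=> p m; rewrite monalg.mcoeff0 mcoeff0 eqxx. Qed.

Lemma homogeneous_path_algD d (f g : PA) : hom d f -> hom d g -> hom d (f + g).
Proof.
move=> hf hg p m; rewrite monalg.mcoeffD mcoeffD.
have [e|ne _] := eqVneq (mcoeff m (monalg.mcoeff p f)) 0; last exact: hf.
by rewrite e add0r; apply: hg.
Qed.

Lemma homogeneous_path_algN d (f : PA) : hom d f -> hom d (- f).
Proof. by move=> hf p m; rewrite monalg.mcoeffN mcoeffN oppr_eq0; apply: hf. Qed.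

Lemma homogeneous_term d (c : Zt) s :
  (forall m, mcoeff m c != 0 -> d = ((mdeg m).*2 + (size s).-1)%N%:Z) -> hom d (c *: pe s).
Proof.
move=> hc p m; rewrite monalg.mcoeffZ; have [q|nq] := boolP (is_qpath F (@adjacent n) s);
  last first.
  by rewrite path_elt0 // monalg.mcoeff0 mulr0 mcoeff0 eqxx.
pose q' : qpath F (@adjacent n) := Sub s q.
rewrite -[s]/(val q') path_elt_val monalg.mcoeffU.
have [<-|_] := eqVneq q' p; last by rewrite mulr0n mulr0 mcoeff0 eqxx.
by rewrite mulr1 => /hc.
Qed.

Lemma homogeneous_mul_arrow d (f : PA) x y : hom d f -> hom (d + 1) (f * arrow V x y).
Proof.
move=> hf; have [q|nq] := boolP (is_qpath F (@adjacent n) [:: x; y]); last first.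
  have -> : f * arrow V x y = 0 by rewrite /arrow (path_elt0 _ nq); apply: pa_mulr0.
  exact: homogeneous_path_alg0.
pose q' : qpath F (@adjacent n) := Sub [:: x; y] q.
have -> : f * arrow V x y = \sum_(p <- finmap.enum_fset (monalg.msupp f))
    monalg.mcoeff p f *: path_mul Zt F (@adjacent n) (val p) [:: x; y].
  apply: eq_bigr => p _; congr (_ *: _).
  by rewrite /arrow -[[:: x; y]]/(val q') path_elt_val [LHS]lin_extU.
apply: (big_ind (hom (d + 1))) => [||p _]; first exact: homogeneous_path_alg0.
  exact: homogeneous_path_algD.
have hp := hf p; case: p hp => -[//|z s] zs hp; rewrite /= in hp *.
case: eqP => _; last by rewrite scaler0; apply: homogeneous_path_alg0.
apply: homogeneous_term => m /hp ->; rewrite /= size_cat /= -PoszD; congr (Posz _); lia.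
Qed.

Lemma homogeneous0 d : Atilde_homogeneous d (0 : A).
Proof. by exists 0; [exact: homogeneous_path_alg0 | rewrite raddf0]. Qed.

Lemma homogeneousD d (y z : A) : Atilde_homogeneous d y -> Atilde_homogeneous d z ->
  Atilde_homogeneous d (y + z).
Proof.
move=> [f hf <-] [g hg <-]; exists (f + g); last by rewrite raddfD.
exact: homogeneous_path_algD.
Qed.

Lemma homogeneous_sign d p (y : A) : Atilde_homogeneous d y ->
  Atilde_homogeneous d (y *~ (-1) ^+ p).
Proof.
move=> [f hf <-]; rewrite -signr_odd; case: (odd p).
  by exists (- f); [exact: homogeneous_path_algN | rewrite raddfN expr1 mulrN1z].
by exists f; rewrite // expr0 mulr1z.
Qed.

Lemma homogeneous_arrow d (y : A) c c' : Atilde_homogeneous d y ->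
  Atilde_homogeneous (d + 1) (y * pi (arrow V c c')).
Proof.
move=> [f hf <-]; exists (f * arrow V c c'); first exact: homogeneous_mul_arrow.
exact: (rmorphM pi).
Qed.

End Grading.

(** * The resolution *)

Section Resolution.
Local Open Scope ring_scope.
Variables (R : realType) (n k : nat) (V : polarized_arrangement R n k).
Variable a : sign_vector n.
Local Notation A := (Atilde V).
Local Notation pi := (rq_pi (@relator R n k V)).
Local Notation x := (mu_inv V a).
Local Notation cube_chain := (cube_chain a).
Local Notation cube_boundary := (cube_boundary a).
Implicit Types (S : {set 'I_n}) (z w : {set 'I_n} -> A) (p : nat).

#[local] Opaque pa_mul rq_mul.

Definition vertex b : A := pi (vertex_idem V b).

Lemma vertex_mul b c : vertex b * pi (arrow V b c) = pi (arrow V b c).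
Proof.
apply: etrans (esym (rmorphM pi _ _)) _; congr (rq_pi _ _).
have [q|nq] := boolP (is_qpath (feasible V) (@adjacent n) [:: b; c]); last first.
  by rewrite /arrow (path_elt0 _ nq); apply: pa_mulr0.
have bF : b \in feasible V by move: q; rewrite isq2 => /and3P[].
by apply: etrans (path_eltM _ _ q) _; rewrite ?is_qpath1 //= eqxx.
Qed.

Lemma vertex_idempotent b : vertex b * vertex b = vertex b.
Proof.
apply: etrans (esym (rmorphM pi _ _)) _; congr (rq_pi _ _).
have [bF|nF] := boolP (b \in feasible V); last first.
  by rewrite /vertex_idem path_elt0 ?is_qpath1 //; apply: pa_mul0r.
by apply: etrans (path_eltM _ _ _) _; rewrite ?is_qpath1 //= eqxx.
Qed.

Lemma vertex_unbounded b : b \notin bounded_above V -> vertex b = 0.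
Proof.
move=> bB; have [bF|nF] := boolP (b \in feasible V).
  by rewrite /vertex; have := @path_class_out _ _ _ V b; rewrite path_classE; apply;
    rewrite inE bB.
by rewrite /vertex /vertex_idem path_elt0 ?is_qpath1 // raddf0.
Qed.

Definition to_principal b (q : A) : Ptilde V b := insubd (0 : principal (vertex b)) q.

Lemma to_principalK b (q : A) : q * vertex b = q ->
  val (to_principal b q : principal (vertex b)) = q.
Proof.
move=> qb; apply: insubdK; rewrite in_principalP ?qb //; exact: vertex_idempotent.
Qed.

Lemma val_principal b (y : Ptilde V b) : (val (y : principal (vertex b)) : A) * vertex b = val y.
Proof.
have : (val (y : principal (vertex b)) : A) \in in_principal (vertex b) by exact: (svalP y).
by rewrite in_principalP ?vertex_idempotent // => /eqP.
Qed.

Definition face p := {S : {set 'I_n} | [&& S \subset x, #|S| == p & flips a S \in bounded_above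
  V]}.

Definition face_term p (j : face p) := gshift p%:Z (Ptilde V (flips a (val j))).

Definition cube_term p : graded_module A := gsum (@face_term p).

(** The summands with a^S unbounded are zero, so the components extend by zero to all S. *)
Definition component p (y : cube_term p) S : A :=
  if insub S is Some j then val ((y : dsum (@face_term p)) j : principal _) else 0.

Definition assemble p z : cube_term p :=
  [ffun j : face p => to_principal (flips a (val j)) (z (val j))].

Lemma component_val p (y : cube_term p) (j : face p) :
  component y (val j) = val ((y : dsum (@face_term p)) j : principal _).
Proof. by rewrite /component valK. Qed.

Lemma component_inj p (y y' : cube_term p) : (forall S, component y S = component y' S) -> y = y'.
Proof.
move=> e; apply/ffunP=> j; apply: val_inj.
by have := e (val j); rewrite !component_val.
Qed.

Lemma component_linear p (c : A) (y y' : cube_term p) S : component (c *: y + y') S =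
  c * component y S + component y' S.
Proof.
rewrite /component; case: insubP => [j _ _|_]; last by rewrite mulr0 addr0.
by rewrite !ffunE.
Qed.

Lemma component_chain p (y : cube_term p) : cube_chain p (component y).
Proof.
move=> S; rewrite /component; case: insubP => [j _ <-|nS]; last by rewrite mul0r.
split; first exact: val_principal.
by have := valP j => /and3P[-> -> _].
Qed.

(** A cube chain takes the value 0 on S when a^S is unbounded, since the idempotent of
    a^S is then zero. *)
Lemma assembleK p z : cube_chain p z -> forall S, component (assemble p z) S = z S.
Proof.
move=> zc S; have [zv z0] := zc S; rewrite /component; case: insubP => [j _ jS|nS].
  by subst S; rewrite ffunE; apply: to_principalK.
have [Sx|Sx] := boolP ((S \subset x) && (#|S| == p)); last by rewrite z0.
move: nS; rewrite andbA Sx /= => /vertex_unbounded v0.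
by rewrite -zv -/(vertex _) v0 mulr0.
Qed.

Lemma cube_boundary_linear (c : A) z w S :
  cube_boundary (fun T => c * z T + w T) S = c * cube_boundary z S + cube_boundary w S.
Proof.
pose t z' l : A := (z' (l |: S) * face_arrow V a (l |: S) S) *~ cube_sign l S.
have dE z' : cube_boundary z' S = \sum_(l in x :\: S) t z' l by [].
rewrite !dE [c * _]mulr_sumr -big_split /=; apply: eq_bigr => l _; rewrite /t.
move: (z _) (w _) (face_arrow _ _ _ _) => q q' r.
by rewrite (mulrDl (c * q)) mulrzDl -mulrA mulrzAr.
Qed.

Lemma eq_cube_boundary z w S : (forall T, z T = w T) -> cube_boundary z S = cube_boundary w S.
Proof. by move=> e; apply: eq_bigr => l _; rewrite e. Qed.

Definition boundary p (y : cube_term p.+1) : cube_term p :=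
  assemble p (cube_boundary (component y)).

Lemma component_boundary p (y : cube_term p.+1) S : component (boundary y) S =
  cube_boundary (component y) S.
Proof. by apply: assembleK; apply/cube_boundary_chain/component_chain. Qed.

Lemma boundary_linear p : linear (@boundary p).
Proof.
move=> c y y'; apply: component_inj => S; apply: etrans (component_boundary _ S) _.
apply: etrans (_ : cube_boundary (fun T => c * component y T + component y' T) S = _).
  by apply: eq_cube_boundary => T; apply: component_linear.
apply: etrans (cube_boundary_linear c _ _ S) _; apply: etrans _ (esym (component_linear _ _ _ S)).
exact: (congr2 (fun q r : A => c * q + r) (esym (component_boundary y S))
  (esym (component_boundary y' S))).
Qed.
HB.instance Definition _ p :=
  GRing.isLinear.Build A (cube_term p.+1) (cube_term p) *:%R (@boundary p) (@boundary_linear p).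

Lemma flips0 : flips a set0 = a.
Proof. by apply/ffunP=> i; rewrite flipsE inE addbF. Qed.

Definition augment (y : cube_term 0) : Vtilde V a :=
  mq_pi (@standard_relation R n k V a) (to_principal a (component y set0)).

Lemma vertex_component_val (y : cube_term 0) :
  val (to_principal a (component y set0) : principal (vertex a)) = component y set0.
Proof. by apply: to_principalK; have [] := component_chain y set0; rewrite flips0. Qed.

Lemma augment_linear : linear augment.
Proof.
move=> c y y'; rewrite /augment -linearP; congr (mq_pi _ _); apply: val_inj.
by rewrite [LHS]vertex_component_val [RHS]linearP /= !vertex_component_val component_linear.
Qed.
HB.instance Definition _ :=
  GRing.isLinear.Build A (cube_term 0) (Vtilde V a) *:%R augment augment_linear.

Lemma cube_term_projective p : projective (cube_term p).
Proof.
by apply: dsum_projective => j; apply: principal_projective; apply: vertex_idempotent.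
Qed.

Lemma homogeneous_component p d (y : cube_term p) S :
  homogeneous d y -> Atilde_homogeneous (d - p%:Z) (component y S).
Proof.
move=> hy; rewrite /component; case: insubP => [j _ _|_]; last exact: homogeneous0.
exact: hy j.
Qed.

Lemma boundary_degree p : degree_preserving (@boundary p).
Proof.
move=> d y hy j; rewrite /= /gshift /=.
have -> : val (boundary y j : principal _) = cube_boundary (component y) (val j).
  by rewrite -component_boundary component_val.
apply: (big_ind (Atilde_homogeneous (d - p%:Z))) => [||l _]; first exact: homogeneous0.
  exact: homogeneousD.
apply: homogeneous_sign; rewrite (_ : d - p%:Z = d - p.+1%:Z + 1).
  exact: homogeneous_arrow (homogeneous_component _ hy).
by rewrite -addn1 PoszD opprD addrA subrK.
Qed.

Lemma augment_degree : degree_preserving augment.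
Proof.
move=> d y hy; exists (to_principal a (component y set0)) => //=.
rewrite vertex_component_val -[d]subr0; exact: (homogeneous_component _ hy).
Qed.

End Resolution.

Section Exactness.
Local Open Scope ring_scope.
Variables (R : realType) (n k : nat) (V : polarized_arrangement R n k).
Variable a : sign_vector n.
Hypothesis aP : a \in bounded_feasible V.
Local Notation A := (Atilde V).
Local Notation pi := (rq_pi (@relator R n k V)).
Local Notation x := (mu_inv V a).
Local Notation cube_chain := (cube_chain a).
Local Notation cube_boundary := (cube_boundary a).
Local Notation cube_term := (cube_term V a).
Local Notation component := (@component R n k V a _).
Local Notation assemble p := (@assemble R n k V a p).
Local Notation boundary p := (@boundary R n k V a p).
Local Notation relation := (@standard_relation R n k V a).
Implicit Types (S : {set 'I_n}) (z w : {set 'I_n} -> A) (p : nat).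

#[local] Opaque pa_mul rq_mul.

Lemma cube_chain0_support z S : cube_chain 0 z -> S != set0 -> z S = 0.
Proof. by move=> zc S0; have [_ ->] := zc S; rewrite // cards_eq0 (negPf S0) andbF. Qed.

Lemma augment_surjective (v : Vtilde V a) : exists y : cube_term 0, augment y = v.
Proof.
have [q <-] := mq_piP v.
pose z S : A := if S == set0 then val (q : principal (vertex V a)) else 0.
have zc : cube_chain 0 z.
  move=> S; rewrite /z; case: eqP => [->|_]; last by rewrite mul0r.
  rewrite flips0; split; first exact: val_principal.
  by rewrite sub0set cards0.
exists (assemble 0 z); rewrite /augment; congr (mq_pi _ _); apply: val_inj.
by apply: etrans (vertex_component_val _) _; rewrite assembleK // /z eqxx.
Qed.

Lemma flips1 l : flips a [set l] = flip a l.
Proof. by apply/ffunP=> i; rewrite flipsE flipE inE. Qed.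

Definition generates (q : A) : Prop :=
  exists2 r : Ptilde V a, in_submod relation r & val (r : principal (vertex V a)) = q.

Lemma generates0 : generates 0.
Proof. by exists 0; [left|]. Qed.

Lemma generatesD q q' : generates q -> generates q' -> generates (q + q').
Proof.
move=> [r rI <-] [r' rI' <-]; exists (r + r') => //.
by apply/submod_predP; apply: rpredD; apply/submod_predP.
Qed.

Lemma generates_arrow (c : A) l : l \in x -> generates (c * pi (arrow V (flip a l) a)).
Proof.
move=> lx; pose r : Ptilde V a := to_principal a (pi (arrow V (flip a l) a)).
have vr : val (r : principal (vertex V a)) = pi (arrow V (flip a l) a).
  by apply: to_principalK; apply: arrow_vertex.
exists (c *: r); last by rewrite /= -vr.
by rewrite -[c *: r]addr0; right; [exists l | left].
Qed.

Lemma cube_boundary0_generates z : generates (cube_boundary z set0).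
Proof.
apply: (big_ind generates) => [||l]; [exact: generates0|exact: generatesD|].
rewrite inE => /andP[_ lx]; rewrite setU0 /face_arrow flips1 flips0 -mulrzAl.
exact: generates_arrow.
Qed.

(** The generator with index l of the relations of the standard module is the image of the
    idempotent in the summand of the singleton of l. *)
Lemma submodule_lifts (r : Ptilde V a) : in_submod relation r ->
  exists2 w, cube_chain 1 w & cube_boundary w set0 = val (r : principal (vertex V a)).
Proof.
elim=> [|c q r' [l lx qE] _ [w wc dw]].
  exists (fun _ => 0) => [S|]; first by rewrite mul0r.
  by rewrite /cube_boundary big1 // => l _; rewrite mul0r mul0rz.
pose u S : A := if S == [set l] then vertex V (flip a l) else 0.
have uc : cube_chain 1 u.
  move=> S; rewrite /u; case: eqP => [->|_]; last by rewrite mul0r.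
  rewrite flips1; split; first exact: vertex_idempotent.
  by rewrite sub1set lx cards1.
exists (fun S => c * u S + w S).
  move=> S; have [u1 u0] := uc S; have [w1 w0] := wc S.
  split=> [|nS]; last by rewrite u0 // w0 // mulr0 addr0.
  apply: etrans (mulrDl (c * u S) (w S) _) _.
  exact: congr2 (etrans (esym (mulrA c (u S) _)) (congr1 (fun y : A => c * y) u1)) w1.
apply: etrans (cube_boundary_linear _ _ _ _ _) _; rewrite dw.
suff E : cube_boundary u set0 = pi (arrow V (flip a l) a).
  by apply: etrans (congr1 (fun y : A => c * y + _) (etrans E (esym qE))) _.
rewrite /cube_boundary (bigD1 l) ?inE ?lx //= big1 ?addr0.
  rewrite setU0 /u eqxx /face_arrow flips1 flips0 vertex_mul.
  rewrite /cube_sign /below (_ : [set j in set0 | _] = set0) ?cards0 ?expr0 ?mulr1z //.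
  by apply/setP=> j; rewrite !inE.
move=> j /andP[_ jl]; rewrite setU0 /u (inj_eq set1_inj) (negPf jl).
by rewrite mul0r mul0rz.
Qed.

Lemma augment_kernel (y : cube_term 0) : augment y = 0 <-> exists y' : cube_term 1,
  boundary 0 y' = y.
Proof.
have mq0 : augment y = 0 <-> in_submod relation (to_principal a (component y set0)).
  rewrite -[X in in_submod _ X]subr0; split=> [e|/mq_pi_eq e].
    apply/mq_pi_eq; apply: etrans e _; exact: esym (linear0 (mq_pi relation)).
  apply: etrans e _; exact: linear0 (mq_pi relation).
split=> [/mq0/submodule_lifts[w wc dw]|[y' yE]].
  exists (assemble 1 w); apply: component_inj => S; apply: etrans (component_boundary _ S) _.
  apply: etrans (_ : cube_boundary w S = _); first by apply: eq_cube_boundary => T;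
    apply: assembleK.
  have [->|S0] := eqVneq S set0; first by apply: etrans dw (vertex_component_val _).
  rewrite (cube_chain0_support (cube_boundary_chain wc) S0); apply/esym.
  exact: cube_chain0_support (component_chain y) S0.
apply/mq0; have [r rI rE] := cube_boundary0_generates (component y').
suff <- : r = to_principal a (component y set0) by [].
apply: val_inj; apply: etrans rE _; apply: etrans _ (esym (vertex_component_val y)).
by rewrite -yE; apply: esym; apply: component_boundary.
Qed.

Lemma boundary_kernel p (y : cube_term p.+1) : boundary p y = 0 <->
  exists y' : cube_term p.+2, boundary p.+1 y' = y.
Proof.
have ext0 S : component (0 : cube_term p) S = 0.
  by rewrite /component; case: insubP => // j _ _; rewrite ffunE.
split=> [y0|[y' <-]].
  have [|w wc dw] := cube_boundary_exact aP (component_chain y).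
    by move=> S; rewrite -component_boundary y0 ext0.
  exists (assemble p.+2 w); apply: component_inj => S; apply: etrans (component_boundary _ S) _.
  apply: etrans (dw S); by apply: eq_cube_boundary => T; apply: assembleK.
apply: component_inj => S; rewrite ext0; apply: etrans (component_boundary _ S) _.
apply: etrans (_ : cube_boundary (cube_boundary (component y')) S = 0).
  by apply: eq_cube_boundary => T; apply: component_boundary.
exact: (cube_boundary_boundary aP S (component_chain y')).
Qed.

Lemma flips_in_cone S : S \subset x -> flips a S \in feasible_cone V x.
Proof.
move=> /subsetP Sx; have [_ muE _] := mu_inv_spec aP.
rewrite inE; apply/forallP=> i; apply/implyP=> ix.
by rewrite muE flipsE (negPf (contra (Sx i) ix)) addbF.
Qed.

End Exactness.

Theorem theorem5p2 (R : realType) (n k : nat) (V : polarized_arrangement R n k)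
    (a : sign_vector n) (ha : a \in bounded_feasible V) :
  has_linear_resolution (Ptilde V)
    (feasible_cone V (mu_inv V a) :&: bounded_above V) (Vtilde V a).
Proof.
exists (face V a), (fun p (j : face V a p) => flips a (val j)).
exists (fun p => @boundary R n k V a p), (@augment R n k V a); split.
- move=> p j; have /and3P[jx _ jB] := valP j.
  by rewrite in_setI jB andbT flips_in_cone.
- exact: cube_term_projective.
- by split; [exact: boundary_degree | exact: augment_degree].
- exact: augment_surjective.
- by split; [exact: augment_kernel | exact: boundary_kernel].
Qed.
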